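(* In the OSC model with known variance $\sigma=1$, with thresholds $\delta_q$ defined with a large enough universal constant $c_0$, there exist universal positive constants $c$ and $n_0$ such that the following holds. For any integer $n\ge n_0$, any integer $k\in\{1,\dots,n-1\}$, any $\theta\in\mathbb R$ and any $\pi\in\overline{\mathcal M}_k$, the estimator $\widetilde\theta_{\mathrm{ad}}=\widetilde\theta_{\widehat q}$ satisfies $$\mathbb E_{\theta,\pi}\big[|\widetilde\theta_{\mathrm{ad}}-\theta|\big]\le c\,\frac{\log\big(\frac{n}{n-k}\big)}{\log^{1/2}\big(1+\frac{k^2}{n}\big)}.$$
   Context: One-sided contamination (OSC) model with known unit variance: $Y_i=\theta+\varepsilon_i$, $1\le i\le n$, $\theta\in\mathbb R$, $\varepsilon_i$ independent with $\varepsilon_i\sim\pi_i$, $\pi=\otimes_i\pi_i$; $\mathbb E_{\theta,\pi}$ denotes expectation. For distributions $P,Q$ on $\mathbb R$, $P\succeq Q$ means $F_P(x)\le F_Q(x)$ for all $x$ (c.d.f.s), and $P\succ Q$ means moreover $F_P(x)<F_Q(x)$ for some $x$. $\overline{\mathcal M}_k=\{\pi=\otimes_{i=1}^n\pi_i:\ \pi_i\succeq\mathcal N(0,1)\ \forall i,\ \sum_i\mathbf 1\{\pi_i\succ\mathcal N(0,1)\}\le k\}$. $Y_{(q)}$ is the $q$-th smallest of $Y_1,\dots,Y_n$; $\overline\Phi$ is the upper tail function of $\mathcal N(0,1)$; $x\vee y=\max(x,y)$. For $1\le q\le\lceil n/2\rceil$, $\widetilde\theta_q=Y_{(q)}+\overline\Phi^{-1}(q/n)$.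 For $x>0$, $\lceil x\rceil^{(\log_2)}=2^{\lceil\log_2 x\rceil}$. Define $$q_k=\begin{cases}\lceil n/2\rceil & \text{if } k\in[1,4\sqrt n),\\ \lceil n^{5/4}/k^{1/2}\rceil^{(\log_2)} & \text{if } k\in[4\sqrt n,\,n-n^{4/5}],\\ 1 & \text{if } k\in(n-n^{4/5},\,n-1],\end{cases}$$ and let $\mathcal Q=\{q_k:\ 1\le k\le n-1\}$ be the collection of values of $q_k$ when $k$ goes from $1$ to $n-1$. The thresholds are $$\delta_q=c_0\sqrt{\log n}\ \text{ if } q<\sqrt2\,n^{1/4},\qquad \delta_q=c_0\,\frac{n^{1/6}}{q^{2/3}\sqrt{\log(n/q)\vee1}}\ \text{ otherwise},$$ where $c_0>0$ is a universal constant taken large enough, and the selected index is $$\widehat q=\max\big\{q\in\mathcal Q:\ |\widetilde\theta_q-\widetilde\theta_{q'}|\le\delta_{q'}\ \text{for all } q'\in\mathcal Q \text{ with } q'<q\big\}.$$ *)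

(* Defs.v *)
From HB Require Import structures.
From mathcomp Require Import all_boot all_order all_algebra.
From mathcomp Require Import all_classical all_reals all_analysis.

Set Implicit Arguments.
Unset Strict Implicit.
Unset Printing Implicit Defensive.

Import Order.TTheory GRing.Theory Num.Theory.
Import numFieldNormedType.Exports.

Local Open Scope classical_set_scope.
Local Open Scope ring_scope.

(* Laws of real random variables; measurableTypeR R is R with its Borel sets,
   under the display for which the library declares normal_prob. *)
Notation real_law R := (probability (measurableTypeR R) R).

Definition gauss01 (R : realType) : real_law R := normal_prob (0 : R) 1.

Definition dist_cdf (R : realType) (P : real_law R) (x : R) : \bar R :=
  P (`]-oo, x]%classic : set R).

Definition stoch_ge (R : realType) (P Q : real_law R) : Prop :=
  forall x, (dist_cdf P x <= dist_cdf Q x)%E.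

Definition stoch_gt (R : realType) (P Q : real_law R) : Prop :=
  stoch_ge P Q /\ exists x, (dist_cdf P x < dist_cdf Q x)%E.

(* A product measure pi_1 x ... x pi_n is given by the family of its
   marginals. *)
Definition Mbar (R : realType) (n k : nat) (pi : 'I_n -> real_law R)
    : Prop :=
  (forall i, stoch_ge (pi i) (gauss01 R)) /\
  (#|[set i : 'I_n | `[< stoch_gt (pi i) (gauss01 R) >] ]%SET| <= k)%N.

Definition mutually_independent d (T : measurableType d) (R : realType)
    (P : probability T R) (n : nat) (X : 'I_n -> {RV P >-> R}) : Prop :=
  forall (J : {set 'I_n}) (A : 'I_n -> set R),
    (forall i, i \in J -> measurable (A i)) ->
    P (\bigcap_(i in [set` J]) (X i @^-1` A i)) =
    (\prod_(i in J) P (X i @^-1` A i))%E.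

(* The joint law of X under P is the product measure pi_1 x ... x pi_n. *)
Definition has_product_law d (T : measurableType d) (R : realType)
    (P : probability T R) (n : nat) (X : 'I_n -> {RV P >-> R})
    (pi : 'I_n -> real_law R) : Prop :=
  mutually_independent X /\
  forall i (A : set R), measurable A -> distribution P (X i) A = pi i A.

(* q-th smallest value, with q counted from 1. *)
Definition order_stat (R : realType) (n : nat) (y : 'I_n -> R) (q : nat) : R :=
  nth 0 (sort <=%R [seq y i | i <- enum 'I_n]) q.-1.

Definition Phibar (R : realType) (t : R) : \bar R := gauss01 R (`]t, +oo[%classic : set R).

(* Inverse of Phibar on ]0, 1[; unspecified outside. *)
Definition Phibar_inv (R : realType) (p : R) : R :=
  get [set t : R | Phibar t = p%:E].

Definition theta_tilde (R : realType) (n : nat) (y : 'I_n -> R) (q : nat) : R :=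
  order_stat y q + Phibar_inv (q%:R / n%:R).

Definition ceil_pow2 (R : realType) (x : R) : R :=
  2 ^ Num.ceil (ln x / ln 2).

(* In the middle range, k <= n gives n^(5/4) / k^(1/2) >= 1, so that
   ceil_pow2 returns a natural number and truncn merely changes its type.
   The rounding can take q_k above ceil(n/2) (but below n) when k is close to
   4 sqrt n; theta_tilde is given by the same formula there. *)
Definition qk (R : realType) (n k : nat) : nat :=
  if k%:R < 4 * Num.sqrt (n%:R : R) then uphalf n
  else if k%:R <= n%:R - ((n%:R : R) `^ (4 / 5)) then
    Num.truncn (ceil_pow2 (((n%:R : R) `^ (5 / 4)) / Num.sqrt k%:R))
  else 1%N.

Definition Qgrid (R : realType) (n : nat) : seq nat :=
  [seq qk R n k | k <- iota 1 n.-1].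

Definition delta (R : realType) (c0 : R) (n q : nat) : R :=
  if q%:R < Num.sqrt 2 * ((n%:R : R) `^ (1 / 4)) then c0 * Num.sqrt (ln n%:R)
  else c0 * (((n%:R : R) `^ (1 / 6)) /
             (((q%:R : R) `^ (2 / 3)) * Num.sqrt (Num.max (ln (n%:R / q%:R)) 1))).

Definition admissible (R : realType) (c0 : R) (n : nat) (y : 'I_n -> R)
    (q : nat) : bool :=
  all (fun q' => (q' < q)%N ==>
         (`|theta_tilde y q - theta_tilde y q'| <= delta c0 n q'))
      (Qgrid R n).

(* The smallest element of the grid is always admissible, so the default
   value 0 of an empty maximum is not reached for n >= 2. *)
Definition qhat (R : realType) (c0 : R) (n : nat) (y : 'I_n -> R) : nat :=
  (\max_(q <- Qgrid R n | admissible c0 y q) q)%N.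

Definition theta_ad (R : realType) (c0 : R) (n : nat) (y : 'I_n -> R) : R :=
  theta_tilde y (qhat c0 y).

(* Main.v *)
Require Import Defs.
From mathcomp Require Import all_boot all_order all_algebra.
From mathcomp Require Import all_classical all_reals all_analysis.
From mathcomp Require Import measurable_realfun ring lra zify.
Import Order.TTheory GRing.Theory Num.Theory.
Import numFieldNormedType.Exports.
Local Open Scope classical_set_scope.
Local Open Scope ring_scope.

Set Implicit Arguments.
Unset Strict Implicit.
Unset Printing Implicit Defensive.

(** Put D_q = theta_tilde_q - theta, L = ln (n/(n-k)) and
    a_q = n^(1/6) / q^(2/3), so that delta_q = c0 a_q / sqrt (ln (n/q)) for the
    grid indices 1 < q <= n/256, which are powers of 2 above n^(3/4).
    Since D_q > h (resp. D_q < -h) means that fewer than q (resp. at least q)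
    noises lie below a fixed level, and such counts are sums of independent
    indicators whose means are controlled by Gaussian tails, Chernoff bounds
    give P(|D_q| > h) <= 2 exp (- (n/q)^(1/3)) as soon as
    h >= 4 (L + 6 a_q) / sqrt (ln (n/q)), for h not too large.

    Lepski's argument is not run with q_k as the target but with the largest
    grid index qs <= n/256 such that L <= a_qs (of order n^(7/4) / k^(3/2)),
    because delta_q dominates the bias of theta_tilde_q as long as q <= qs.  If
    no such index exists, qs is the second smallest element of the grid, and it
    is 1 if L is of order ln n.  When every grid index q <= qs satisfies
    |D_q| <= eta_q, where eta_q = delta_q / 2 (except for q = qs in the second
    case, where eta_qs has the order of the rate), qs is admissible and the
    error is at most eta_qs + delta_qs; otherwise, if r is the least violated
    index, its predecessor in the grid is admissible and the error is at most
    twice the threshold of that predecessor.  Summing these thresholds against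
    P(r violated) costs O(n^(-1/2)), which is below the rate. *)

(** * Gaussian tails *)

Section gauss.
Context {R : realType}.
Notation mu := (@lebesgue_measure R).
Notation pdf := (normal_pdf (0 : R) 1).

Lemma normal_pdf01E (x : R) : pdf x = normal_peak (1 : R) * expR (- x ^+ 2 / 2).
Proof. by rewrite normal_pdfE ?oner_neq0// /normal_fun subr0 expr1n. Qed.

Lemma normal_pdf_shift (h x : R) :
  pdf (x - h) = expR (h * x - h ^+ 2 / 2) * pdf x.
Proof.
rewrite !normal_pdf01E [RHS]mulrCA; congr (_ * _).
by rewrite -expRD; congr expR; field.
Qed.

Lemma normal_pdfN (x : R) : pdf (- x) = pdf x.
Proof. by rewrite !normal_pdf01E sqrrN. Qed.

Lemma normal_peak1_le1 : normal_peak (1 : R) <= 1.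
Proof.
have p2 : 1 <= pi *+ 2 :> R by have := pi_ge2 R; lra.
rewrite /normal_peak expr1n mul1r invf_le1; last first.
  by rewrite sqrtr_gt0 (lt_le_trans _ p2).
by rewrite -[leLHS]sqrtr1 ler_sqrt// (le_trans _ p2).
Qed.

(** The term [- 2] pays for the peak: [2 * pi <= 8 <= 9 <= (expR 2) ^+ 2], hence
    [1 / sqrt (2 * pi) >= expR (- 2)]. *)
Lemma normal_pdf_ge (M x : R) : `|x| <= M -> expR (- M ^+ 2 / 2 - 2) <= pdf x.
Proof.
move=> xM; rewrite normal_pdf01E addrC expRD ler_pM ?expR_ge0//.
  have p2 : 1 <= pi *+ 2 :> R by have := pi_ge2 R; lra.
  have p4 : pi <= 4 :> R by have := pihalf_lt2 R; lra.
  have e3 : 3 <= expR 2 :> R by apply: le_trans (expR_ge1Dx 2); lra.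
  have sp : 0 < Num.sqrt (pi *+ 2) :> R by rewrite sqrtr_gt0 (lt_le_trans _ p2).
  rewrite /normal_peak expr1n mul1r expRN lef_pV2 ?posrE ?expR_gt0//.
  rewrite -[leRHS]ger0_norm ?expR_ge0// -sqrtr_sqr ler_sqrt ?sqr_ge0//.
  nra.
rewrite ler_expR; have : x ^+ 2 <= M ^+ 2.
  by move: xM; rewrite ler_norml => /andP[]; nra.
lra.
Qed.

Definition Phi (t : R) : R := fine (gauss01 R (`]-oo, t]%classic : set R)).

Lemma PhiE (t : R) : gauss01 R (`]-oo, t]%classic : set R) = (Phi t)%:E.
Proof. by rewrite fineK// fin_num_measure. Qed.

Lemma Phi_ge0 (t : R) : 0 <= Phi t.
Proof. by rewrite -lee_fin -PhiE. Qed.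

Lemma le_Phi (s t : R) : s <= t -> Phi s <= Phi t.
Proof.
move=> st; rewrite -lee_fin -!PhiE le_measure ?inE//.
by move=> x /=; rewrite !in_itv/= => /le_trans; exact.
Qed.

Lemma measurable_pdfE (D : set R) : measurable_fun D (EFin \o pdf).
Proof.
apply: measurable_funTS; apply/measurable_EFinP.
exact: measurable_normal_pdf.
Qed.

(** Exponential tilting: translating by [h] multiplies the density at [x] by
    [expR (h * x - h ^+ 2 / 2)], which on []-oo, t]] is largest at [t]. Applied near the quantile
    [- tau], this shows that a shift by [h] changes the tail by a factor of about
    [expR (h * tau)]. *)
Lemma Phi_shift (h t : R) : 0 <= h ->
  Phi (t - h) <= expR (h * t - h ^+ 2 / 2) * Phi t.
Proof.
move=> h0; rewrite -lee_fin EFinM -!PhiE /gauss01/= /normal_prob.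
have F'E : (fun x : R => x - h)^`()%classic = cst 1.
  by apply/funext => x; rewrite derive1E deriveB// derive_id derive_cst subr0.
rewrite (@increasing_ge0_integration_by_substitutionNy R (fun x => x - h))//.
- rewrite [leLHS](_ : _ = (\int[mu]_(x in `]-oo, t]) (pdf (x - h))%:E)%E); last first.
    by apply: eq_integral => x _; rewrite F'E /= mulr1.
  have mh : measurable_fun `]-oo, t] (fun x : R => (pdf (x - h))%:E).
    apply: measurable_funTS; apply/measurable_EFinP.
    apply: measurableT_comp; first exact: measurable_normal_pdf.
    exact: measurable_funB.
  rewrite -ge0_integralZl//=; last 2 first.
  + exact: measurable_pdfE.
  + by move=> x _; rewrite lee_fin normal_pdf_ge0.
  apply: ge0_le_integral => //=.
  + by move=> x _; rewrite lee_fin normal_pdf_ge0.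
  + by apply: measurable_funeM; exact: measurable_pdfE.
  move=> x; rewrite in_itv/= => xt; rewrite normal_pdf_shift lee_fin.
  by rewrite ler_wpM2r ?normal_pdf_ge0// ler_expR lerD2r ler_wpM2l.
- by move=> x y _ _; rewrite ltrD2r.
- by rewrite F'E => x _; exact: cvg_cst.
- by rewrite F'E; exact: is_cvg_cst.
- by rewrite F'E; exact: cvg_cst.
- split => [x _|]; first by [].
  by apply: cvgB; [exact: cvg_at_left_filter|exact: cvg_cst].
- exact: cvg_addrr_Ny.
- by apply: continuous_subspaceT; exact: continuous_normal_pdf.
- by move=> x _; rewrite normal_pdf_ge0.
Qed.

Lemma Phi_lower (t : R) : 0 <= t ->
  expR (- (t + 1) ^+ 2 / 2 - 2) <= Phi (- t).
Proof.
move=> t0; rewrite -lee_fin -PhiE /gauss01/= /normal_prob.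
apply: (@le_trans _ _ (\int[mu]_(x in `](- t - 1)%R, (- t)%R]) (expR (- (t + 1) ^+ 2
  / 2 - 2))%:E)%E).
  rewrite integral_cst//= lebesgue_measure_itv/= lte_fin ifT; last by lra.
  by rewrite -EFinB -EFinM lee_fin ler_peMr ?expR_ge0//; lra.
apply: (@le_trans _ _ (\int[mu]_(x in `](- t - 1)%R, (- t)%R]) (pdf x)%:E)%E).
  apply: ge0_le_integral => //=.
  - exact: measurable_pdfE.
  move=> x; rewrite in_itv/= => /andP[x1 x2]; rewrite lee_fin normal_pdf_ge//.
  by rewrite ler_norml; lra.
apply: ge0_subset_integral => //=.
- exact: measurable_pdfE.
- by move=> x _; rewrite lee_fin normal_pdf_ge0.
- by move=> x /=; rewrite !in_itv/= => /andP[].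
Qed.

Lemma PhibarE (t : R) : Phibar t = (Phi (- t))%:E.
Proof.
rewrite -PhiE /Phibar /gauss01/= /normal_prob ge0_integration_by_substitutionNy.
- rewrite integral_itv_obnd_cbnd; last exact: measurable_pdfE.
  by apply: eq_integral => x _; rewrite /= normal_pdfN.
- by apply: continuous_subspaceT; exact: continuous_normal_pdf.
- by move=> x _; rewrite normal_pdf_ge0.
Qed.

Lemma PhiN (t : R) : Phi (- t) = 1 - Phi t.
Proof.
apply/EFin_inj; rewrite -PhibarE EFinB -PhiE /Phibar.
rewrite -probability_setC//; congr (_ _); apply/seteqP; split => x /=;
  by rewrite !in_itv/= andbT ltNge => /negP.
Qed.

Lemma Phi_lipschitz (s t : R) : s <= t -> Phi t - Phi s <= t - s.
Proof.
move=> st; rewrite lerBlDr -lee_fin EFinD -!PhiE.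
have -> : `]-oo, t]%classic = `]s, t] `|` `]-oo, s].
  by rewrite setUC -itv_bndbnd_setU// bnd_simp.
apply: le_trans (measureU2 _ _ _) _ => //; rewrite leeD2r//.
rewrite /gauss01/= /normal_prob.
apply: (@le_trans _ _ (\int[mu]_(x in `]s, t]) (cst 1%:E) x)%E).
  apply: ge0_le_integral => //=.
  - by move=> x _; rewrite lee_fin normal_pdf_ge0.
  - exact: measurable_pdfE.
  - move=> x _; rewrite lee_fin (le_trans (normal_pdf_ub _ _ _))//.
    exact: normal_peak1_le1.
rewrite integral_cst//= lebesgue_measure_itv/= mul1e lte_fin.
by case: ltP => // ts; rewrite lee_fin subr_ge0.
Qed.

Lemma Phi_le_exp (t : R) : 0 <= t -> Phi (- t) <= expR (- t ^+ 2 / 2).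
Proof.
move=> t0; have := Phi_shift 0 t0; rewrite sub0r mulr0 sub0r.
rewrite -mulNr => /le_trans; apply; rewrite ler_piMr ?expR_ge0//.
by rewrite -lee_fin -PhiE probability_le1.
Qed.

(** [Phibar_inv] is a choice operator, so a solution has to be exhibited. [Phi] is 1-Lipschitz,
    hence continuous, and the intermediate value theorem applies on [[- M, M]] once the tails at [M]
    are below both [p] and [1 - p]. *)
Lemma Phi_Phibar_inv (p : R) : 0 < p < 1 -> Phi (- Phibar_inv p) = p.
Proof.
move=> /andP[p0 p1]; suff [t tp] : exists t, Phi t = p.
  apply/EFin_inj; rewrite -PhibarE /Phibar_inv.
  apply: (@getPex _ [set t | Phibar t = p%:E]); exists (- t) => /=.
  by rewrite PhibarE opprK tp.
have [M [M0 Mp Mp']] : exists M, [/\ 0 <= M, expR (- M ^+ 2 / 2) <= p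
    & expR (- M ^+ 2 / 2) <= 1 - p].
  pose e := Num.min p (1 - p).
  have e0 : 0 < e by rewrite lt_min p0 subr_gt0.
  suff [M M0 Me] : exists2 M, 0 <= M & expR (- M ^+ 2 / 2) <= e.
    by exists M; split => //; rewrite (le_trans Me)// ge_min lexx ?orbT.
  have lne : ln e <= 0 by rewrite ln_le0// ge_min (ltW p1).
  exists (2 - 2 * ln e); first by lra.
  by rewrite -[leRHS](@lnK _ e) ?posrE// ler_expR; nra.
have cPhi : {within `[- M, M], continuous Phi}.
  apply: continuous_subspaceT => x; apply/cvgrPdist_le => e e0; near=> y.
  have xy : `|x - y| <= e.
    by near: y; exists e => // z /ltW.
  apply: le_trans xy; case: (leP x y) => [xy|/ltW xy].
    rewrite (distrC (Phi x)) (distrC x) !ger0_norm ?subr_ge0 ?le_Phi//.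
    exact: Phi_lipschitz.
  by rewrite !ger0_norm ?subr_ge0 ?le_Phi// Phi_lipschitz.
have MM : - M <= M by lra.
have [|t _ tp] := IVT MM cPhi (v := p); last by exists t.
have := Phi_le_exp M0; have := PhiN M => e1 e2.
by rewrite ge_min le_max; apply/andP; split; apply/orP; [left|right]; lra.
Unshelve. all: by end_near. Qed.

Lemma Phi_le_exp_tail (c t : R) : 0 <= t -> Phi (- t) = c -> - ln c >= t ^+ 2 / 2.
Proof.
move=> t0 tc; have := Phi_le_exp t0; rewrite tc => cl.
have c0 : 0 < c.
  rewrite -tc; apply: lt_le_trans (Phi_lower t0); exact: expR_gt0.
by move: cl; rewrite -ler_ln ?posrE ?expR_gt0// expRK; lra.
Qed.

(** [Phi_lower] bounds [- ln (Phi (- t))] by [(t + 1) ^+ 2 / 2 + 2], which is at most [4 * t ^+ 2]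
    as soon as [t >= 1]. *)
Lemma Phi_quantile_ge (t : R) : ln (Phi (- t)) <= - 4 ->
  Num.sqrt (- ln (Phi (- t))) / 2 <= t.
Proof.
set x := Phi (- t) => x4.
have lb s : 0 <= s -> - s <= - t -> - (s + 1) ^+ 2 / 2 - 2 <= ln x.
  move=> s0 st; rewrite -[leLHS]expRK ler_ln ?posrE ?expR_gt0//.
    exact: le_trans (Phi_lower s0) (le_Phi st).
  by apply: lt_le_trans (le_Phi st); apply: lt_le_trans (Phi_lower s0); exact: expR_gt0.
have t1 : 1 <= t.
  (* If [t < 1], a level [s] in [[0, 1[] with [t <= s] would force the logarithm above [- 4]. *)
  rewrite leNgt; apply/negP => t1; pose s := (Num.max t 0 + 1) / 2.
  have [s0 s1 st] : [/\ 0 <= s, s < 1 & t <= s].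
    by rewrite /s; case: (leP t 0) => ?; split; lra.
  by have := lb s s0 ltac:(lra); nra.
have t0 : 0 <= t by lra.
rewrite ler_pdivrMr// -[leRHS]ger0_norm ?mulr_ge0// -sqrtr_sqr ler_sqrt ?sqr_ge0//.
by have := lb t t0 (lexx _); nra.
Qed.

End gauss.

(** * Counting noises below a level *)

Lemma measure_bigsetU_le d (T : measurableType d) (R : realType)
    (P : probability T R) (I : Type) (s : seq I) (B : pred I) (F : I -> set T) :
  (forall i, measurable (F i)) ->
  (P (\big[setU/set0]_(i <- s | B i) F i) <= \sum_(i <- s | B i) P (F i))%E.
Proof.
move=> mF; elim: s => [|a s IH]; first by rewrite !big_nil measure0.
rewrite !big_cons; case: (B a) => //.
apply: le_trans (measureU2 _ _ _) _ => //; first exact: bigsetU_measurable.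
by rewrite leeD2l.
Qed.

Section counting.
Context d (T : measurableType d) (R : realType) (P : probability T R) (n : nat).
Variables (X : 'I_n -> {RV P >-> R}) (t : R).
Hypothesis indepX : mutually_independent X.

Definition below (w : T) : {set 'I_n} := [set i | X i w <= t]%SET.

Definition below_prob (i : 'I_n) : R := fine (P (X i @^-1` `]-oo, t]%classic)).

(** The side of [t] on which [X i] must fall for the set of indices below [t] to be [J]; it turns
    this event into an intersection to which independence applies. *)
Let half (J : {set 'I_n}) (i : 'I_n) : set R :=
  if i \in J then `]-oo, t]%classic else `]t, +oo[%classic.

Let mhalf J i : measurable (X i @^-1` half J i).
Proof.
rewrite -[X in measurable X]setTI; apply: measurable_funP => //.
by rewrite /half; case: ifP.
Qed.

Let below_eq J : [set w | below w = J] =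
  \bigcap_(i in [set` [set: 'I_n]%SET]) (X i @^-1` half J i).
Proof.
apply/seteqP; split => w /=.
  move=> <- i _; rewrite /half inE; case: ifP => /=; rewrite in_itv/=//.
  by move=> /negbT; rewrite -ltNge andbT.
move=> h; apply/setP => i; have := h i; rewrite /= inE => /(_ isT).
rewrite /half inE; case: ifP => _ /=; rewrite in_itv/= ?andbT//.
by rewrite leNgt => ->.
Qed.

Let below_eq_measurable J : measurable [set w | below w = J].
Proof. by rewrite below_eq; apply: fin_bigcap_measurable. Qed.

Lemma below_probE i : P (X i @^-1` `]-oo, t]%classic) = (below_prob i)%:E.
Proof.
rewrite fineK// fin_num_measure// -[X in measurable X]setTI.
exact: measurable_funP.
Qed.

Lemma prob_below_eq J : P [set w | below w = J] =
  (\prod_i (if i \in J then below_prob i else 1 - below_prob i))%:E.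
Proof.
rewrite below_eq indepX; last by move=> i _; rewrite /half; case: ifP.
rewrite -prodEFin; apply: eq_big => [i|i _]; first by rewrite inE.
rewrite /half; case: ifP => _; first exact: below_probE.
rewrite EFinB -below_probE -probability_setC; last first.
  by rewrite -[X in measurable X]setTI; exact: measurable_funP.
congr (P _); apply/seteqP; split => w /=; by rewrite !in_itv/= andbT ltNge => /negP.
Qed.

Let below_split (B : pred {set 'I_n}) :
  [set w | B (below w)] = \big[setU/set0]_(J | B J) [set w | below w = J].
Proof.
apply/seteqP; split => [w /= Bw|].
  by rewrite (bigD1 (below w))//=; left.
by apply: (big_ind (fun S => S `<=` [set w | B (below w)])) =>
  [//|S1 S2 h1 h2 w [/h1|/h2]//|J BJ w /= ->].
Qed.

Lemma measurable_below (B : pred {set 'I_n}) : measurable [set w | B (below w)].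
Proof. by rewrite below_split; apply: bigsetU_measurable. Qed.

(** Markov's inequality for [z ^+ #|J|], written as a finite sum over the possible sets [J]. The
    condition on [z ^+ r] lets [z < 1] serve the lower tail and [z > 1] the upper one. *)
Lemma chernoff_below (B : pred {set 'I_n}) (z : R) (r : nat) : 0 < z ->
  (forall J, B J -> z ^+ r <= z ^+ #|J|) ->
  (P [set w | B (below w)] <=
    (z ^- r * expR ((z - 1) * \sum_i below_prob i))%:E)%E.
Proof.
move=> z0 zB; have p01 i : 0 <= below_prob i <= 1.
  by rewrite -!lee_fin -below_probE measure_ge0 probability_le1// -[X in measurable
    X]setTI; exact: measurable_funP.
pose w (J : {set 'I_n}) := \prod_i (if i \in J then below_prob i else 1 - below_prob i).
have w0 J : 0 <= w J.
  by apply: prodr_ge0 => i _; have := p01 i; case: ifP => _; lra.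
apply: (@le_trans _ _ (\sum_(J | B J) w J)%:E).
  rewrite below_split.
  apply: (@le_trans _ _ (\sum_(J | B J) P [set w | below w = J])%E).
    exact: measure_bigsetU_le.
  by rewrite -sumEFin lee_sum// => J _; rewrite prob_below_eq.
rewrite lee_fin mulrC ler_pdivlMr ?exprn_gt0// mulr_suml.
apply: (@le_trans _ _ (\sum_J w J * z ^+ #|J|)).
  rewrite big_mkcond; apply: ler_sum => J _; case: ifP => BJ.
    by rewrite ler_wpM2l// zB.
  by rewrite mulr_ge0// exprn_ge0// ltW.
(* The generating function factors: expanding the product decides for each [i] whether it belongs to
   [J]. *)
have -> : \sum_J w J * z ^+ #|J| = \prod_i (z * below_prob i + (1 - below_prob i)).
  rewrite bigA_distr; apply: eq_bigr => J _.
  rewrite -prodr_const (big_mkcond (mem J)) -big_split/=; apply: eq_bigr => i _.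
  by case: ifP => _; rewrite ?mulr1// mulrC.
rewrite mulr_sumr expR_sum; apply: ler_prod => i _.
have := p01 i => pi; apply/andP; split; first by nra.
by apply: le_trans (expR_ge1Dx _); lra.
Qed.

End counting.

(** * Order statistics as counts *)

Section order_stat.
Context {R : realType}.

Lemma nth_sort_le (s : seq R) (q : nat) (t : R) : (0 < q <= size s)%N ->
  (nth 0 (sort <=%R s) q.-1 <= t) = (q <= count (fun x : R => x <= t)%R s)%N.
Proof.
move=> /andP[q0 qs]; set s' := sort _ s.
have ss : size s' = size s by rewrite size_sort.
have so : sorted <=%R s' by apply: sort_sorted; exact: le_total.
have cc : count (fun x : R => x <= t)%R s = count (fun x => x <= t) s'.
  by apply/permP; rewrite perm_sym perm_sort.
have mono i j : (i <= j < size s')%N -> nth 0 s' i <= nth 0 s' j.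
  move=> /andP[ij js]; apply: (sorted_leq_nth le_trans le_refl) => //.
  by rewrite inE (leq_ltn_trans ij).
rewrite {}cc; apply/idP/idP => [qt|].
  rewrite -[s'](cat_take_drop q) count_cat.
  have /eqP -> : count (fun x : R => x <= t)%R (take q s') == size (take q s').
    rewrite -all_count; apply/(all_nthP 0) => i; rewrite size_takel ?ss// => iq.
    rewrite nth_take//; apply: le_trans qt; apply: mono.
    by rewrite ss prednK// qs andbT -ltnS prednK.
  by rewrite size_takel ?ss// leq_addr.
apply: contraTT; rewrite -ltNge -ltnNge => tq.
rewrite -[s'](cat_take_drop q.-1) count_cat.
have -> : count (fun x : R => x <= t)%R (drop q.-1 s') = 0%N.
  apply/eqP; rewrite -leqn0 leqNgt -has_count; apply/hasPn => x.
  move=> /(nthP 0)[i]; rewrite size_drop nth_drop => iq <-.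
  rewrite -ltNge; apply: (lt_le_trans tq); apply: mono.
  by rewrite leq_addr/= -ltn_subRL.
rewrite addn0; apply: (leq_ltn_trans (count_size _ _)).
by rewrite size_take_min (leq_ltn_trans (geq_minl _ _))// prednK.
Qed.

Lemma order_stat_le (n : nat) (y : 'I_n -> R) (q : nat) (t : R) :
  (0 < q <= n)%N ->
  (order_stat y q <= t) = (q <= #|[set i | (y i <= t)%R]%SET|)%N.
Proof.
move=> qn; rewrite /order_stat nth_sort_le; last by rewrite size_map size_enum_ord.
rewrite count_map; congr (q <= _)%N.
rewrite cardE -size_filter; congr size; rewrite {2}/enum_mem -enumT.
by apply: eq_filter => i /=; rewrite inE.
Qed.

End order_stat.

(** * Chernoff bounds for the counts *)

Section exp_bounds.
Context {R : realType}.
Implicit Type x : R.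

(** From [expR x >= 1 + x] and [(1 - x + x ^+ 2) * (1 + x) = 1 + x ^+ 3]. *)
Lemma expRN_le x : 0 <= x -> expR (- x) <= 1 - x + x ^+ 2.
Proof.
move=> x0; rewrite expRN -div1r ler_pdivrMr ?expR_gt0//.
apply: (@le_trans _ _ ((1 - x + x ^+ 2) * (1 + x))); first by nra.
by rewrite ler_wpM2l ?expR_ge1Dx//; nra.
Qed.

(** From [(1 - x) * expR x <= 1] and [(1 - x) * (1 + x + 2 * x ^+ 2) = 1 + x ^+ 2 * (1 - 2 * x)]. *)
Lemma expR_le_quad x : 0 <= x <= 1 / 2 -> expR x <= 1 + x + 2 * x ^+ 2.
Proof.
move=> /andP[x0 x1]; have x2 : 0 < 1 - x by lra.
have : 1 - x <= expR (- x) by apply: le_trans (expR_ge1Dx _); lra.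
rewrite expRN => h; have e0 := expR_gt0 x.
have {}h : (1 - x) * expR x <= 1 by rewrite -ler_pdivlMr// div1r.
have : (1 - x) * expR x <= (1 - x) * (1 + x + 2 * x ^+ 2) by nra.
by rewrite ler_pM2l.
Qed.

End exp_bounds.

Section chernoff.
Context d (T : measurableType d) (R : realType) (P : probability T R) (n : nat).
Variables (X : 'I_n -> {RV P >-> R}) (t : R).
Hypothesis indepX : mutually_independent X.

Lemma prob_few_below (q : nat) (s : R) : 0 <= s <= 1 ->
  q%:R * (1 + s) <= \sum_i below_prob X t i ->
  (P [set w | (#|below X t w| < q)%N] <= (expR (- (q%:R * s ^+ 2 / 8)))%:E)%E.
Proof.
(* The exponent per unit of [q] is at most [- l * s + 2 * l ^+ 2], which is minimal at [l = s / 4]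
   with value [- s ^+ 2 / 8]. *)
move=> /andP[s0 s1] m; pose l := s / 4.
have z1 : expR (- l) <= 1 by rewrite expR_le1 /l; lra.
apply: (le_trans (chernoff_below t indepX (B := fun J => (#|J| < q)%N)
  (z := expR (- l)) (r := q) _ _)); first exact: expR_gt0.
  by move=> J /ltnW Jq; rewrite ler_wiXn2l ?expR_ge0.
rewrite lee_fin -expRM_natl -expRN -expRD ler_expR.
have q0 : 0 <= q%:R :> R by [].
have := @expRN_le R l; rewrite {1}/l => /(_ ltac:(lra)) hl.
have h1 : (expR (- l) - 1) * (\sum_i below_prob X t i) <=
  (- l + l ^+ 2) * (q%:R * (1 + s)).
  apply: (@le_trans _ _ ((- l + l ^+ 2) * \sum_i below_prob X t i)).
    rewrite ler_wpM2r; first by [].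
      by apply: le_trans m; nra.
    by lra.
  by rewrite ler_wnM2l// /l; nra.
apply: (le_trans (lerD (lexx _) h1)).
rewrite mulrN opprK.
have -> : q%:R * l + (- l + l ^+ 2) * (q%:R * (1 + s)) =
  q%:R * (l + (- l + l ^+ 2) * (1 + s)) by ring.
have h2 : l + (- l + l ^+ 2) * (1 + s) <= - (s ^+ 2 / 8) by rewrite /l; nra.
by have := ler_wpM2l q0 h2; lra.
Qed.

Lemma prob_many_below (q : nat) (s : R) : 0 <= s <= 1 ->
  \sum_i below_prob X t i <= q%:R * (1 - s) ->
  (P [set w | (q <= #|below X t w|)%N] <= (expR (- (q%:R * s ^+ 2 / 8)))%:E)%E.
Proof.
move=> /andP[s0 s1] m; pose l := s / 4.
have z1 : 1 <= expR l by rewrite -expR0 ler_expR /l; lra.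
apply: (le_trans (chernoff_below t indepX (B := fun J => (q <= #|J|)%N)
  (z := expR l) (r := q) _ _)); first exact: expR_gt0.
  by move=> J Jq; rewrite ler_weXn2l.
rewrite lee_fin -expRM_natl -expRN -expRD ler_expR.
have q0 : 0 <= q%:R :> R by [].
have := @expR_le_quad R l; rewrite {1 2}/l => /(_ ltac:(lra)) hl.
have h1 : (expR l - 1) * (\sum_i below_prob X t i) <=
  (l + 2 * l ^+ 2) * (q%:R * (1 - s)).
  apply: (@le_trans _ _ ((expR l - 1) * (q%:R * (1 - s)))).
    by rewrite ler_wpM2l// subr_ge0.
  by rewrite ler_wpM2r ?mulr_ge0//; lra.
apply: (le_trans (lerD (lexx _) h1)).
have -> : - (q%:R * l) + (l + 2 * l ^+ 2) * (q%:R * (1 - s)) =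
  q%:R * (- l + (l + 2 * l ^+ 2) * (1 - s)) by ring.
have h2 : - l + (l + 2 * l ^+ 2) * (1 - s) <= - (s ^+ 2 / 8) by rewrite /l; nra.
by have := ler_wpM2l q0 h2; lra.
Qed.

End chernoff.

(** * Deviations under one-sided contamination *)

Section contaminated.
Context d (T : measurableType d) (R : realType) (P : probability T R) (n k : nat).
Variables (eps : 'I_n -> {RV P >-> R}) (pi : 'I_n -> real_law R).
Hypothesis lawE : has_product_law eps pi.
Hypothesis piM : Mbar k pi.

Lemma below_prob_le i (t : R) : below_prob eps t i <= Phi t.
Proof.
rewrite /below_prob.
have -> : P (eps i @^-1` `]-oo, t]%classic) = pi i (`]-oo, t]%classic : set R).
  by rewrite -lawE.2.
rewrite /Phi fine_le ?fin_num_measure//; exact: piM.1.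
Qed.

Definition clean : {set 'I_n} := ~: [set i | `[< stoch_gt (pi i) (gauss01 R) >]]%SET.

(** Dominating the Gaussian law without doing so strictly means having the same c.d.f. *)
Lemma below_prob_clean i (t : R) : i \in clean -> below_prob eps t i = Phi t.
Proof.
rewrite !inE => /asboolPn ni; apply/eqP; rewrite eq_le below_prob_le/=.
rewrite leNgt; apply/negP => lt; apply: ni; split; first exact: piM.1.
exists t; rewrite /dist_cdf PhiE.
have -> : pi i (`]-oo, t]%classic : set R) = (below_prob eps t i)%:E.
  by rewrite -below_probE -lawE.2.
by rewrite lte_fin.
Qed.

Lemma card_clean : (n - k <= #|clean|)%N.
Proof.
by rewrite /clean cardsCs finset.setCK card_ord leq_sub2l// piM.2.
Qed.

Lemma sum_below_prob_le (t : R) : \sum_i below_prob eps t i <= n%:R * Phi t.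
Proof.
apply: (@le_trans _ _ (\sum_(i < n) Phi t)).
  by apply: ler_sum => i _; exact: below_prob_le.
by rewrite sumr_const card_ord mulr_natl.
Qed.

(** Contaminated noises may be arbitrarily large, so only the clean ones are counted. The lost
    factor [(n - k) / n] is what makes [ln (n / (n - k))] appear as a bias. *)
Lemma sum_below_prob_ge (t : R) :
  (n - k)%:R * Phi t <= \sum_i below_prob eps t i.
Proof.
apply: (@le_trans _ _ (\sum_(i in clean) Phi t)).
  by rewrite sumr_const -[leRHS]mulr_natl ler_wpM2r ?Phi_ge0// ler_nat card_clean.
rewrite big_mkcond; apply: ler_sum => i _; case: ifP => [ic|_].
  by rewrite below_prob_clean.
by rewrite /below_prob fine_ge0.
Qed.

Lemma order_stat_gt (theta v : R) (q : nat) (w : T) : (0 < q <= n)%N ->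
  (v < order_stat (fun i => theta + eps i w) q - theta) =
  (#|below eps v w| < q)%N.
Proof.
move=> qn; rewrite ltrBrDl ltNge order_stat_le// -ltnNge; congr (_ < _)%N.
by apply: eq_card => i; rewrite !inE lerD2l.
Qed.

Lemma order_stat_lt (theta v : R) (q : nat) (w : T) : (0 < q <= n)%N ->
  order_stat (fun i => theta + eps i w) q - theta < v ->
  (q <= #|below eps v w|)%N.
Proof.
move=> qn; rewrite ltrBlDl => /ltW; rewrite order_stat_le//.
by congr (_ <= _)%N; apply: eq_card => i; rewrite !inE lerD2l.
Qed.

(** Contains the event that [theta_tilde] at [q] errs by more than [h]. Being stated through counts,
    it is free of [theta], measurable, and ready for the Chernoff bounds. *)
Definition deviant (q : nat) (h : R) : set T :=
  let tau := Phibar_inv (q%:R / n%:R) in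
  [set w | (#|below eps (h - tau) w| < q)%N] `|`
  [set w | (q <= #|below eps (- h - tau) w|)%N].

Lemma measurable_deviant q h : measurable (deviant q h).
Proof.
apply: measurableU.
  exact: (measurable_below _ _ (fun J => (#|J| < q)%N)).
exact: (measurable_below _ _ (fun J => (q <= #|J|)%N)).
Qed.

Lemma deviantP (theta h : R) (q : nat) (w : T) : (0 < q <= n)%N ->
  h < `|theta_tilde (fun i => theta + eps i w) q - theta| -> deviant q h w.
Proof.
move=> qn; rewrite /theta_tilde ltr_normr => /orP[lt|lt].
  by left; rewrite /= -(order_stat_gt theta)//; lra.
by right => /=; apply: (@order_stat_lt theta) => //; lra.
Qed.

(** At the level [- tau] an uncontaminated count has mean [q]. Raising the level by [h] multiplies
    the mean by at least [expR (h * tau / 2)], which covers the contamination loss and leaves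
    [q * (1 + s)]. Lowering it gives at most [q * expR (- s) <= q * (1 - s / 2)], whence the
    constant [32]. *)
Lemma prob_deviant (q : nat) (h s : R) : (0 < q < n)%N -> (k < n)%N ->
  let tau := Phibar_inv (q%:R / n%:R) in
  0 <= s <= 1 / 2 -> 0 <= h -> h <= tau / 2 ->
  ln (n%:R / (n%:R - k%:R)) + s <= h * tau / 2 ->
  (P (deviant q h) <= (2 * expR (- (q%:R * s ^+ 2 / 32)))%:E)%E.
Proof.
move=> /andP[q0 qn] kn tau /andP[s0 s1] h0 htau hL.
have n0 : 0 < n%:R :> R by rewrite ltr0n (ltn_trans q0).
have nk0 : 0 < n%:R - k%:R :> R by rewrite subr_gt0 ltr_nat.
have q0' : 0 < q%:R :> R by rewrite ltr0n.
have Ptau : Phi (- tau) = q%:R / n%:R.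
  by apply: Phi_Phibar_inv; rewrite divr_gt0//= ltr_pdivrMr// mul1r ltr_nat.
set L := ln _ in hL.
have L0 : 0 <= L.
  by apply: ln_ge0; rewrite ler_pdivlMr// mul1r gerBl.
have eL : expR (- L) = (n%:R - k%:R) / n%:R.
  by rewrite expRN lnK ?invf_div// posrE divr_gt0.
apply: (le_trans (measureU2 _ _ _)).
- exact: (measurable_below _ _ (fun J => (#|J| < q)%N)).
- exact: (measurable_below _ _ (fun J => (q <= #|J|)%N)).
rewrite [2 * _]mulr_natl [_ *+ 2]mulr2n EFinD; apply: leeD.
  apply: (@le_trans _ _ (expR (- (q%:R * s ^+ 2 / 8)))%:E); last first.
    rewrite lee_fin ler_expR; have : 0 <= q%:R * s ^+ 2 by nra.
    by lra.
  apply: (prob_few_below lawE.1); first by apply/andP; split; lra.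
  apply: le_trans (sum_below_prob_ge _).
  have := Phi_shift (h - tau) h0; rewrite addrAC subrr sub0r Ptau => sh.
  have {}sh : expR (h * tau / 2) * (q%:R / n%:R) <= Phi (h - tau).
    apply: (@le_trans _ _ (expR (- (h * (h - tau) - h ^+ 2 / 2)) * (q%:R / n%:R))).
      by rewrite ler_wpM2r ?divr_ge0// ?ler_expR; nra.
    by rewrite expRN mulrC ler_pdivrMr ?expR_gt0// [leRHS]mulrC.
  apply: (@le_trans _ _ ((n - k)%:R * (expR (h * tau / 2) * (q%:R / n%:R))));
    last first.
    by rewrite ler_wpM2l.
  rewrite natrB ?(ltnW kn)//.
  have -> : (n%:R - k%:R) * (expR (h * tau / 2) * (q%:R / n%:R)) =
    q%:R * (expR (- L) * expR (h * tau / 2)) by rewrite eL; field; rewrite gt_eqF.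
  rewrite ler_wpM2l// -expRD; apply: le_trans (expR_ge1Dx _) _.
  by rewrite ler_expR; lra.
apply: (@le_trans _ _ (expR (- (q%:R * (s / 2) ^+ 2 / 8)))%:E); last first.
  by rewrite lee_fin ler_expR; lra.
apply: (prob_many_below lawE.1); first by apply/andP; split; lra.
apply: le_trans (sum_below_prob_le _) _.
have := Phi_shift (- tau) h0; rewrite Ptau addrC => sh.
apply: (@le_trans _ _ (n%:R * (expR (- s) * (q%:R / n%:R)))).
  rewrite ler_wpM2l// (le_trans sh)// ler_wpM2r ?divr_ge0// ler_expR; nra.
rewrite mulrC mulrA divfK ?gt_eqF// mulrC ler_wpM2l//.
by apply: le_trans (expRN_le s0) _; nra.
Qed.

(** If all noises exceed [v], so does one fixed clean noise, and [k < n] provides one. The other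
    event is a union bound over the [n] noises. *)
Lemma prob_extreme (v : R) : (k < n)%N -> 0 <= v ->
  (P ([set w | (#|below eps v w| < 1)%N] `|` [set w | (1 <= #|below eps (- v) w|)%N])
    <= ((n%:R + 1) * expR (- v ^+ 2 / 2))%:E)%E.
Proof.
move=> kn v0; apply: (le_trans (measureU2 _ _ _)).
- exact: (measurable_below _ _ (fun J => (#|J| < 1)%N)).
- exact: (measurable_below _ _ (fun J => (1 <= #|J|)%N)).
have mX t i : measurable (eps i @^-1` `]-oo, t]%classic).
  by rewrite -[X in measurable X]setTI; exact: measurable_funP.
have bE t i := below_probE eps t i.
rewrite mulrDl mul1r addrC EFinD; apply: leeD; last first.
  have [i0 ic] : exists i, i \in clean.
    by apply/set0Pn; rewrite -card_gt0 (leq_trans _ card_clean)// subn_gt0.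
  apply: (@le_trans _ _ (P (~` (eps i0 @^-1` `]-oo, v]%classic)))).
    apply: le_measure; rewrite ?inE//.
    - exact: (measurable_below _ _ (fun J => (#|J| < 1)%N)).
    - exact: measurableC.
    - move=> w /=; rewrite ltnS leqn0 cards_eq0 => /eqP w0; rewrite in_itv/= => h.
      by have := finset.in_set0 i0; rewrite -w0 inE h.
  rewrite probability_setC// bE -EFinB below_prob_clean// lee_fin -PhiN.
  exact: Phi_le_exp.
apply: (@le_trans _ _ (P (\big[setU/set0]_(i < n) (eps i @^-1` `]-oo, - v]%classic)))).
  apply: le_measure; rewrite ?inE//.
  - exact: (measurable_below _ _ (fun J => (1 <= #|J|)%N)).
  - exact: bigsetU_measurable.
  - move=> w /=; rewrite card_gt0 => /set0Pn[i]; rewrite inE => h.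
    by rewrite (bigD1 i)//=; left; rewrite /= in_itv.
apply: (le_trans (measure_bigsetU_le _ _ _ _)) => //.
rewrite (eq_bigr _ (fun i _ => bE (- v) i)) sumEFin lee_fin.
apply: le_trans (sum_below_prob_le _) _.
by rewrite ler_wpM2l// Phi_le_exp.
Qed.

End contaminated.

(** * The grid of indices *)

Section powers.
Context {R : realType}.
Implicit Type x : R.

(* All exponents of n in the problem, except 4/5, are multiples of 1/12. *)
Definition root12 (n : nat) : R := n%:R `^ (1 / 12).

Lemma powR_div12 (n m : nat) : n%:R `^ (m%:R / 12) = root12 n ^+ m.
Proof.
by rewrite -powR_mulrn ?powR_ge0// -powRrM; congr (_ `^ _); field.
Qed.

Lemma ln2_gt0 : 0 < ln 2 :> R.
Proof. by apply: ln_gt0; rewrite ltr1n. Qed.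

Lemma ceil_pow2_eq x (j : nat) : 2 ^+ j < x <= 2 ^+ j.+1 ->
  ceil_pow2 x = 2 ^+ j.+1.
Proof.
move=> /andP[x1 x2]; have x0 : 0 < x by apply: lt_trans x1; rewrite exprn_gt0.
rewrite /ceil_pow2 (@ceil_def _ _ j.+1)//.
rewrite ltr_pdivlMr ?ler_pdivrMr ?ln2_gt0//.
have -> : (j.+1%:Z - 1)%:~R = j%:R :> R by rewrite -addn1 PoszD addrK.
rewrite !mulr_natl -!lnXn// ltr_ln ?posrE ?exprn_gt0// x1/=.
by rewrite ler_ln ?posrE ?exprn_gt0.
Qed.

Lemma ceil_pow2_ge x : 1 <= x -> exists2 j : nat, ceil_pow2 x = 2 ^+ j & x <= 2 ^+ j.
Proof.
move=> x1; have x0 : 0 < x by apply: lt_le_trans x1.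
have c0 : 0 <= Num.ceil (ln x / ln 2).
  by rewrite ceil_ge0 (lt_le_trans (ltrN10 _))// divr_ge0 ?ln_ge0// ler1n.
exists `|Num.ceil (ln x / ln 2)|%N.
  by rewrite /ceil_pow2 -[in LHS](gez0_abs c0).
set m := `|_|%N; suff : ln x <= ln (2 ^+ m) by rewrite ler_ln ?posrE ?exprn_gt0.
rewrite lnXn// -[_ *+ m]mulr_natl -ler_pdivrMr ?ln2_gt0//.
by rewrite natr_absz ger0_norm// ceil_ge.
Qed.

End powers.

Section grid.
Context {R : realType}.
Variable n : nat.
Local Notation N := (n%:R : R).
Local Notation b := (@root12 R n).
Hypothesis n_large : 2 ^+ 40 <= N.

Lemma root12_gt0 : 0 < b.
Proof. by rewrite /root12 powR_gt0// (lt_le_trans _ n_large)// exprn_gt0. Qed.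

Lemma root12E : N = b ^+ 12.
Proof.
by rewrite -powR_div12 divff// powRr1// ler0n.
Qed.

Lemma root12_ge8 : 8 <= b.
Proof.
have b0 := root12_gt0; rewrite leNgt; apply/negP => b8.
have : b ^+ 12 < 8 ^+ 12 by rewrite ltrXn2r// ltW.
rewrite -root12E => /(le_lt_trans n_large).
have -> : 8 = 2 ^+ 3 :> R by rewrite -natrX.
by rewrite -exprM ltr_eXn2l ?ltr1n.
Qed.

Let sqrtN : Num.sqrt N = b ^+ 6.
Proof. by rewrite root12E (exprM b 6 2) sqrtr_sqr ger0_norm// exprn_ge0// ltW//
  root12_gt0. Qed.

Let N54 : N `^ (5 / 4) = b ^+ 15.
Proof. by rewrite -powR_div12; congr (_ `^ _); field. Qed.

Let N_ge1 : 1 < N.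
Proof. by apply: lt_le_trans n_large; rewrite exprn_egt1 ?ltr1n. Qed.

Let N45_gt1 : 1 < N `^ (4 / 5).
Proof.
have : 1 `^ (4 / 5) < N `^ (4 / 5).
  by rewrite gt0_ltr_powR ?nnegrE ?ler0n// ?divr_gt0.
by rewrite powR1.
Qed.

Let N45_le : N `^ (4 / 5) <= N / 4.
Proof.
have N0 : 0 < N by apply: lt_trans N_ge1.
pose g := N `^ (1 / 5); have g0 : 0 < g by exact: powR_gt0.
have gN : g ^+ 5 = N by rewrite -powR_mulrn ?ltW// -powRrM divfK// powRr1// ltW.
have -> : N `^ (4 / 5) = g ^+ 4.
  by rewrite -powR_mulrn ?ltW// -powRrM; congr (_ `^ _); field.
suff g4 : 4 <= g by rewrite ler_pdivlMr// -gN [g ^+ 5]exprSr ler_wpM2l// exprn_ge0//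
  ltW.
rewrite leNgt; apply/negP => g4.
have : g ^+ 5 < 4 ^+ 5 by rewrite ltrXn2r// ltW.
rewrite gN => /(le_lt_trans n_large); have -> : 4 = 2 ^+ 2 :> R by rewrite -natrX.
by rewrite -exprM ltr_eXn2l ?ltr1n.
Qed.

(** Since [k <= n], the ratio [n^(5/4) / k^(1/2)] is at least [n^(3/4) = b ^+ 9], and rounding only
    increases it. *)
Lemma qk_values (k : nat) : (0 < k < n)%N ->
  [\/ qk R n k = 1%N, qk R n k = uphalf n |
      exists2 j, qk R n k = (2 ^ j)%N & b ^+ 9 <= (2 ^ j)%:R].
Proof.
move=> /andP[k0 kn]; rewrite /qk; case: ifP => [_|kb]; first by constructor 2.
case: ifP => [_|_]; last by constructor 1.
constructor 3; have b0 := root12_gt0; have b8 := root12_ge8.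
have k0' : 0 < k%:R :> R by rewrite ltr0n.
have sk : 0 < Num.sqrt k%:R :> R by rewrite sqrtr_gt0.
have z9 : b ^+ 9 <= N `^ (5 / 4) / Num.sqrt k%:R.
  rewrite ler_pdivlMr// N54 (exprD b 9 6) ler_wpM2l ?exprn_ge0 ?(ltW b0)//.
  by rewrite -sqrtN ler_sqrt ?ler0n// ler_nat ltnW.
have [|j jE jz] := @ceil_pow2_ge R (N `^ (5 / 4) / Num.sqrt k%:R).
  by apply: le_trans z9; rewrite exprn_ege1//; lra.
exists j; last by rewrite natrX (le_trans z9).
by rewrite jE -natrX natrK.
Qed.

(** The value is reached at [k = n - 1], which lies beyond [n - n^(4/5)] because [n^(4/5) > 1]. *)
Lemma one_in_grid : 1%N \in Qgrid R n.
Proof.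
have n1 : (1 < n)%N.
  by rewrite -(ltr_nat R); apply: lt_le_trans n_large; rewrite exprn_egt1 ?ltr1n.
apply/mapP; exists n.-1; first by rewrite mem_iota; lia.
have nE : n.-1%:R = N - 1 by rewrite -subn1 natrB// ltnW.
have b8 := root12_ge8; rewrite /qk nE sqrtN; case: ifP => [h|_]; last first.
  by case: ifP => // h; exfalso; move: h N45_gt1; lra.
exfalso; have b6 : 8 ^+ 6 <= b ^+ 6 by rewrite ler_pXn2r ?nnegrE//; lra.
have : 8 <= 8 ^+ 6 :> R by rewrite ler_eXnr ?ler1n.
by move: h b6; rewrite root12E (exprM b 6 2); nra.
Qed.

(** With [r = 2 ^ j], the index [k] is taken just above [x = n^(5/2) / r^2], so that
    [n^(5/4) / k^(1/2)] lies in []r / 2, r]] and rounds up to [r]. The bounds on [r] place [x]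
    between [16 * sqrt n] and [n / 4], inside the middle range. *)
Lemma pow2_in_grid (j : nat) : 2 * b ^+ 9 <= (2 ^ j)%:R <= N / 4 ->
  (2 ^ j)%N \in Qgrid R n.
Proof.
rewrite natrX => /andP[j1 j2]; have b8 := root12_ge8; have b0 := root12_gt0.
have N0 : 0 < N by apply: lt_trans N_ge1.
pose r : R := 2 ^+ j; have r0 : 0 < r by rewrite exprn_gt0.
pose x := b ^+ 30 / r ^+ 2.
have xr : x * r ^+ 2 = b ^+ 30 by rewrite divfK// gt_eqF// exprn_gt0.
have x16 : 16 * b ^+ 6 <= x.
  rewrite ler_pdivlMr ?exprn_gt0//.
  have r4 : 4 * r <= N by move: j2; rewrite -/r; lra.
  have : (4 * r) ^+ 2 <= N ^+ 2 by nra.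
  rewrite root12E -exprM (exprD b 6 24) => /(ler_wpM2l (exprn_ge0 6 (ltW b0))).
  by lra.
have b61 : 1 <= b ^+ 6 by rewrite exprn_ege1//; lra.
have x1 : 16 <= x by lra.
have x4 : x <= N / 4.
  rewrite ler_pdivrMr ?exprn_gt0//.
  have : (2 * b ^+ 9) ^+ 2 <= r ^+ 2 by rewrite ler_pXn2r ?nnegrE ?mulr_ge0
    ?exprn_ge0// ltW.
  rewrite exprMn -exprM => /(ler_wpM2l (ltW N0)).
  by rewrite root12E (exprD b 12 18); lra.
pose k := (Num.truncn x).+1.
have xk : x < k%:R by rewrite truncnS_gt.
have kx : k%:R <= x + 1.
  by rewrite /k -addn1 natrD lerD2r truncn_le// (le_trans _ x1).
have N4 : 4 <= N.
  by apply: le_trans n_large; rewrite (_ : 4 = 2 ^+ 2) ?ler_eXn2l ?ltr1n// -natrX.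
have k0 : 0 < k%:R :> R by rewrite ltr0n.
apply/mapP; exists k.
  have : (k <= n.-1)%N.
    rewrite -ltnS prednK -?(ltr_nat R); last by lra.
    lra.
  by move=> kn; rewrite mem_iota add1n ltnS kn.
rewrite /qk sqrtN ifF; last by apply/negbTE; rewrite -leNgt; lra.
rewrite ifT; last by move: N45_le; lra.
rewrite N54.
have sk : 0 < Num.sqrt k%:R :> R by rewrite sqrtr_gt0.
have sk2 : Num.sqrt k%:R ^+ 2 = k%:R :> R by rewrite sqr_sqrtr// ltW.
have [i ji] : exists i, j = i.+1.
  exists j.-1; rewrite prednK// lt0n; apply/eqP => j0.
  have : 8 <= b ^+ 9 by rewrite (le_trans b8)// ler_eXnr//; lra.
  by move: j1; rewrite j0 expr0; lra.
rewrite ji (@ceil_pow2_eq _ _ i) ?natrK// -?ji -?natrX ?natrK//.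
rewrite natrX -/r; apply/andP; split.
  rewrite ltr_pdivlMr//.
  have r2 : 2 ^+ i = r / 2 by rewrite /r ji exprSr mulfK.
  have : (r / 2 * Num.sqrt k%:R) ^+ 2 < (b ^+ 15) ^+ 2.
    by rewrite exprMn sk2 -exprM -xr; nra.
  by rewrite r2 ltr_pXn2r// ?nnegrE ?mulr_ge0 ?exprn_ge0 ?ltW// divr_gt0.
rewrite ler_pdivrMr//.
have : (b ^+ 15) ^+ 2 <= (r * Num.sqrt k%:R) ^+ 2.
  by rewrite [leRHS]exprMn sk2 -exprM -xr; nra.
rewrite natrX -/r => h; rewrite -(@ler_pXn2r _ 2)// nnegrE.
  by rewrite exprn_ge0// ltW.
by rewrite mulr_ge0// ltW.
Qed.

End grid.

(** * Lepski's selection rule *)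

(** The integral of a nonnegative function is a supremum over the simple functions below it. Thus
    the risk can be compared with measurable majorants while treating [theta_ad] as an arbitrary
    function. *)
Lemma le_integral_ge0 d (T : measurableType d) (R : realType)
    (mu : {measure set T -> \bar R}) (f g : T -> \bar R) :
  (forall x, 0 <= f x)%E -> (forall x, f x <= g x)%E ->
  (\int[mu]_x f x <= \int[mu]_x g x)%E.
Proof.
move=> f0 fg; rewrite !ge0_integralTE//; last by move=> x; exact: le_trans (fg x).
by apply: le_ereal_sup => _ /= [h hf <-]; exists h => // x; exact: le_trans (fg x).
Qed.

Lemma expectation_le_series d (T : measurableType d) (R : realType)
    (P : probability T R) (f : T -> R) (A B : R) (h : nat -> T -> R) (v : nat -> R) :
  (forall w, 0 <= f w) -> 0 <= A -> (forall j w, 0 <= h j w) ->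
  (forall j, measurable_fun [set: T] (h j)) ->
  (forall j, (\int[P]_w (h j w)%:E <= (v j)%:E)%E) ->
  (forall m, \sum_(0 <= j < m) v j <= B) ->
  (forall w, f w <= A \/ exists j, f w <= h j w) ->
  ('E_P[f] <= (A + B)%:E)%E.
Proof.
move=> f0 A0 h0 mh hv vB fh; rewrite unlock.
pose G w := (A%:E + \sum_(0 <= j <oo) (h j w)%:E)%E.
have h0' j w : (0 <= (h j w)%:E)%E by rewrite lee_fin.
have mh' j : measurable_fun [set: T] (fun w => (h j w)%:E) by exact/measurable_EFinP.
apply: (@le_trans _ _ (\int[P]_w G w)%E).
  apply: le_integral_ge0 => w; first by rewrite lee_fin.
  have S0 : (0 <= \sum_(0 <= j <oo) (h j w)%:E)%E by exact: nneseries_ge0.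
  have [fA|[j fj]] := fh w.
    by rewrite /G -[leLHS]adde0 leeD ?lee_fin.
  apply: (@le_trans _ _ (0 + (h j w)%:E)%E); first by rewrite add0e lee_fin.
  apply: leeD; first by rewrite lee_fin.
  apply: le_trans (nneseries_lim_ge j.+1 _) => //.
  by rewrite big_nat_recr//= leeDr// sume_ge0.
rewrite ge0_integralD//=; last 2 first.
- by move=> w _; exact: nneseries_ge0.
- exact: ge0_emeasurable_sum.
rewrite integral_cst//= probability_setT mule1 EFinD leeD2l// integral_nneseries//.
apply: lime_le.
  by apply: is_cvg_nneseries => j _ _; exact: integral_ge0.
apply: nearW => m; apply: (@le_trans _ _ (\sum_(0 <= j < m) (v j)%:E)%E).
  exact: lee_sum.
by rewrite sumEFin lee_fin.
Qed.

Lemma bigmax_seq_attained (s : seq nat) (adm : pred nat) (r : nat) :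
  r \in s -> adm r ->
  let m := (\max_(q <- s | adm q) q)%N in [/\ m \in s, adm m & (r <= m)%N].
Proof.
move=> rs ar m; have rm : (r <= m)%N by exact: leq_bigmax_seq.
(* If the maximum is 0, then [r <= m] forces [r = 0], so the default value of an empty maximum is
   still attained. *)
have [m0|m0] := posnP m; first by rewrite m0 leqn0 in rm *; rewrite -(eqP rm).
suff : (m \in s) && adm m by case/andP.
have : (m == 0%N) || (m \in s) && adm m.
  clear rm m0; rewrite {}/m big_seq_cond; elim/big_ind: _ => //.
    move=> x y hx hy; rewrite /maxn; case: ifP => _ //.
  by move=> i ->; rewrite orbT.
by rewrite eqn0Ngt m0.
Qed.

Section lepski.
Context {R : realType} (n : nat) (c0 theta : R) (y : 'I_n -> R).
Notation Q := (Qgrid R n).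
Notation D := (fun q => theta_tilde y q - theta).

(** An admissible [q] satisfies [q <= qhat], and the admissibility of [qhat] itself then compares
    the two estimators within [delta c0 n q]. *)
Lemma theta_ad_le (q : nat) : q \in Q -> 0 <= delta c0 n q ->
  (forall r, r \in Q -> (r < q)%N ->
    `|theta_tilde y q - theta_tilde y r| <= delta c0 n r) ->
  `|theta_ad c0 y - theta| <= `|D q| + delta c0 n q.
Proof.
move=> qQ d0 adm; have aq : admissible c0 y q.
  by apply/allP => r rQ; apply/implyP => rq; exact: adm.
have [mQ am qm] := bigmax_seq_attained qQ aq; rewrite /theta_ad /qhat.
set m := (\max_(_ <- _ | _) _)%N in mQ am qm *.
have := qm; rewrite leq_eqVlt => /predU1P[<-|qm']; first by rewrite lerDl.
move/allP : am => /(_ _ qQ)/implyP/(_ qm') h.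
rewrite -(subrKA (theta_tilde y q)) (le_trans (ler_normD _ _))// addrC lerD2l//.
Qed.

(** Deterministic half of the argument. As long as no index up to [q] is violated, the triangle
    inequality through [theta] makes [q] admissible. This is applied to [qs], or to every grid index
    below the least violated one. *)
Lemma lepski_cases (eta : nat -> R) (qs : nat) : qs \in Q ->
  (forall r, r \in Q -> 0 <= delta c0 n r) ->
  (forall r r', r \in Q -> r' \in Q -> (r' < r <= qs)%N ->
     eta r + eta r' <= delta c0 n r') ->
  `|theta_ad c0 y - theta| <= eta qs + delta c0 n qs \/
  exists r, [/\ r \in Q, (r <= qs)%N, eta r < `|D r| &
    forall q, q \in Q -> (q < r)%N ->
      `|theta_ad c0 y - theta| <= eta q + delta c0 n q].
Proof.
move=> qsQ d0 etaD.
pose bad r := [&& r \in Q, (r <= qs)%N & eta r < `|D r|].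
have good q : q \in Q -> (q <= qs)%N -> (forall r, (r <= q)%N -> ~~ bad r) ->
    `|theta_ad c0 y - theta| <= eta q + delta c0 n q.
  move=> qQ qqs ng; have gr r : r \in Q -> (r <= q)%N -> `|D r| <= eta r.
    move=> rQ rq; have := ng _ rq; rewrite /bad rQ (leq_trans rq)//=.
    by rewrite -leNgt.
  apply: (le_trans (theta_ad_le qQ _ _)) => [|r rQ rq|]; first exact: d0.
    rewrite -(subrKA theta) (le_trans (ler_normD _ _))//.
    apply: le_trans (etaD q r qQ rQ _); last by rewrite rq.
    by rewrite lerD ?gr// ?(ltnW rq)// distrC gr// ltnW.
  by rewrite lerD2r gr.
have [exb|nb] := pselect (exists r, bad r); last first.
  left; apply: good => // r _; apply/negP => br; apply: nb; by exists r.
right; have [r /and3P[rQ rqs br] rmin] := ex_minnP exb.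
exists r; split => // q qQ qr; apply: good => //.
  by rewrite (leq_trans (ltnW qr)).
move=> r' r'q; apply/negP => /rmin; rewrite leqNgt => /negP; apply.
exact: leq_ltn_trans qr.
Qed.

End lepski.

(** * Thresholds *)

Section analytic.
Context {R : realType}.
Implicit Types x u : R.

Lemma pow_expRN_le (m : nat) : exists2 M : R, 0 < M &
  forall u, 0 <= u -> u ^+ m.+1 * expR (- u) <= M.
Proof.
exists (m.+1)`!%:R; first by rewrite ltr0n fact_gt0.
move=> u u0; rewrite expRN ler_pdivrMr ?expR_gt0//.
have := expR_ge1Dxn m u0; have f0 : 0 < (m.+1)`!%:R :> R by rewrite ltr0n fact_gt0.
rewrite -lerBrDl ler_pdivrMr// => /le_trans; apply.
by lra.
Qed.

Lemma ln2_ge : 1 / 2 <= ln 2 :> R.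
Proof.
rewrite -[leLHS]expRK ler_ln ?posrE ?expR_gt0//.
by apply: le_trans (expR_le_quad _) _; lra.
Qed.

Lemma ln_ge4 x : 256 <= x -> 4 <= ln x.
Proof.
move=> x256; apply: (@le_trans _ _ (ln (2 ^+ 8))).
  by rewrite lnXn// -[_ *+ 8]mulr_natl; have := ln2_ge; lra.
by rewrite ler_ln ?posrE ?exprn_gt0//; [rewrite -natrX|]; lra.
Qed.

Lemma cuberoot_pow x : 0 <= x -> (x `^ (1 / 3)) ^+ 3 = x.
Proof.
by move=> x0; rewrite -powR_mulrn ?powR_ge0// -powRrM divfK// powRr1.
Qed.

Lemma powR_two_thirds x : 0 <= x -> x `^ (2 / 3) = (x `^ (1 / 3)) ^+ 2.
Proof.
by move=> x0; rewrite -powR_mulrn ?powR_ge0// -powRrM; congr (_ `^ _); field.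
Qed.

Lemma ler_pow3 x y : 0 <= x -> 0 <= y -> (x ^+ 3 <= y ^+ 3) = (x <= y).
Proof. by move=> x0 y0; rewrite ler_pXn2r. Qed.

End analytic.

Section threshold.
Context {R : realType}.
Variable n : nat.
Local Notation N := (n%:R : R).
Local Notation b := (@root12 R n).
Hypothesis n_large : 2 ^+ 40 <= N.

(* The factor n^(1/6) / r^(2/3) of delta_r. *)
Definition amp (r : nat) : R := b ^+ 2 / (r%:R `^ (1 / 3)) ^+ 2.
Definition ell (r : nat) : R := Num.sqrt (ln (N / r%:R)).
(** This is [(n / r)^(1/3)]; it equals [r * amp r ^+ 2], the order of the Chernoff exponent for a
    relative deviation [amp r]. *)
Definition cuberatio (r : nat) : R := b ^+ 4 / r%:R `^ (1 / 3).

(** The range of the grid powers of 2 that are used. The factor 256 gives [ln (n / r) >= 4], which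
    makes the maximum with 1 in [delta] inactive and allows [Phi_quantile_ge]. *)
Definition mid (r : nat) := (b ^+ 9 <= r%:R) && (256 * r%:R <= N).

Let b0 : 0 < b. Proof. exact: root12_gt0. Qed.
Let b8 : 8 <= b. Proof. exact: root12_ge8. Qed.
Let NE : N = b ^+ 12. Proof. exact: root12E. Qed.
Let N0 : 0 < N. Proof. by rewrite NE exprn_gt0. Qed.

Lemma midE r : mid r = (b ^+ 9 <= r%:R) && (256 * r%:R <= N).
Proof. by []. Qed.

Lemma mid_gt0 r : mid r -> 0 < r%:R :> R.
Proof. by move=> /andP[h _]; apply: lt_le_trans h; rewrite exprn_gt0. Qed.

Let bge0 : 0 <= b. Proof. exact: ltW. Qed.

Let v0 r : mid r -> 0 < r%:R `^ (1 / 3) :> R.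
Proof. by move=> /mid_gt0 r0; exact: powR_gt0. Qed.

Lemma amp_gt0 r : mid r -> 0 < amp r.
Proof. by move=> m; rewrite divr_gt0// exprn_gt0// v0. Qed.

Lemma cuberatio_pow3 r : mid r -> cuberatio r ^+ 3 = N / r%:R.
Proof.
by move=> m; rewrite exprMn exprVn cuberoot_pow ?ler0n// -exprM NE.
Qed.

Lemma amp_cuberatio r : mid r -> amp r = cuberatio r ^+ 2 / b ^+ 6.
Proof.
by move=> m; rewrite /amp /cuberatio; field; rewrite !gt_eqF ?v0.
Qed.

Lemma amp_sqr r : mid r -> r%:R * amp r ^+ 2 = cuberatio r.
Proof.
move=> m; rewrite /amp /cuberatio -[X in X * _](@cuberoot_pow _ r%:R) ?ler0n//.
by field; rewrite gt_eqF ?v0.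
Qed.

Lemma cuberatio_ge6 r : mid r -> 6 <= cuberatio r.
Proof.
move=> m; have r0 := mid_gt0 m; rewrite -ler_pow3 ?divr_ge0 ?exprn_ge0 ?powR_ge0//.
rewrite cuberatio_pow3// ler_pdivlMr//; have /andP[_] := m.
by rewrite -natrX; lra.
Qed.

Lemma cuberoot_ge r : mid r -> b ^+ 3 <= r%:R `^ (1 / 3).
Proof.
move=> m; rewrite -ler_pow3 ?exprn_ge0 ?powR_ge0// cuberoot_pow ?ler0n//.
by rewrite -exprM; case/andP: m.
Qed.

Lemma amp_le_root r : mid r -> amp r * b ^+ 4 <= 1.
Proof.
move=> m; rewrite /amp mulrAC ler_pdivrMr ?exprn_gt0 ?v0// [leRHS]mul1r -exprD.
by rewrite (exprM b 3 2) ler_pXn2r ?nnegrE ?exprn_ge0 ?powR_ge0 ?cuberoot_ge.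
Qed.

Lemma ellP r : mid r -> ell r ^+ 2 = ln (N / r%:R) /\ 2 <= ell r.
Proof.
move=> m; have r0 := mid_gt0 m.
have l4 : 4 <= ln (N / r%:R).
  by apply: ln_ge4; rewrite ler_pdivlMr//; case/andP: m.
split; first by rewrite sqr_sqrtr// (le_trans _ l4).
rewrite -[leLHS]ger0_norm// -sqrtr_sqr ler_sqrt ?(le_trans _ l4)//.
by rewrite -natrX.
Qed.

Lemma delta_mid (c0 : R) r : mid r -> delta c0 n r = c0 * (amp r / ell r).
Proof.
move=> m; rewrite /delta ifF; last first.
  apply/negbTE; rewrite -leNgt; have /andP[br _] := m; apply: le_trans br.
  have -> : N `^ (1 / 4) = b ^+ 3.
    by rewrite -powR_div12; congr (_ `^ _); field.
  have s2 : Num.sqrt 2 <= 2 :> R.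
    by rewrite -[leRHS]ger0_norm// -sqrtr_sqr ler_sqrt// -natrX ler_nat.
  rewrite (exprD b 6 3) ler_wpM2r ?exprn_ge0//.
  have h8 := b8; have b6 : b <= b ^+ 6 by rewrite ler_eXnr//; lra.
  lra.
have -> : N `^ (1 / 6) = b ^+ 2.
  by rewrite -powR_div12; congr (_ `^ _); field.
rewrite powR_two_thirds ?ler0n// max_l; last first.
  by have [<- l2] := ellP m; nra.
rewrite /amp -/(ell r); congr (_ * _).
by rewrite invfM mulrA.
Qed.

Lemma delta_one (c0 : R) : delta c0 n 1 = c0 * Num.sqrt (ln N).
Proof.
rewrite /delta ifT//.
have -> : N `^ (1 / 4) = b ^+ 3.
  by rewrite -powR_div12; congr (_ `^ _); field.
have s1 : 1 <= Num.sqrt 2 :> R by rewrite -[leLHS]sqrtr1 ler_sqrt// ler1n.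
have h8 := b8; have : 8 <= b ^+ 3 by rewrite (le_trans b8)// ler_eXnr//; lra.
by nra.
Qed.

Lemma lnN_ge : 12 <= ln N.
Proof.
rewrite NE lnXn// -[_ *+ 12]mulr_natl.
have : ln (2 ^+ 3) <= ln b.
  by rewrite ler_ln ?posrE ?exprn_gt0//; rewrite -natrX.
by rewrite lnXn// -[_ *+ 3]mulr_natl; have := ln2_ge (R := R); lra.
Qed.

Lemma ler_amp r r' : mid r -> mid r' -> (r' <= r)%N -> amp r <= amp r'.
Proof.
move=> m m' rr; rewrite /amp ler_wpM2l ?exprn_ge0// lef_pV2 ?posrE ?exprn_gt0 ?v0//.
rewrite ler_pXn2r ?nnegrE ?powR_ge0//.
by rewrite ge0_ler_powR ?nnegrE ?ler0n// ?ler_nat// divr_ge0.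
Qed.

(** Let [z = r / r'] and square. The logarithm grows by a factor at most [z] from [r] to [r'],
    because [ln z <= z - 1] and [ln (n / r) >= 1], while [amp ^+ 2] grows by [z^(4/3)]. *)
Lemma ler_amp_ell r r' : mid r -> mid r' -> (r' <= r)%N ->
  amp r / ell r <= amp r' / ell r'.
Proof.
move=> m m' rr; have r0 := mid_gt0 m; have r0' := mid_gt0 m'.
have [e2 l2] := ellP m; have [e2' l2'] := ellP m'.
have l0 : 0 < ell r by lra.
have l0' : 0 < ell r' by lra.
rewrite ler_pdivrMr// mulrAC ler_pdivlMr//.
have a0 := amp_gt0 m; have a0' := amp_gt0 m'.
rewrite -(@ler_pXn2r _ 2) ?nnegrE ?mulr_ge0 ?(ltW l0) ?(ltW l0') ?(ltW a0) ?(ltW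
  a0')// (exprMn 2 (amp r)) (exprMn 2 (amp r')) e2 e2'.
pose z : R := r%:R / r'%:R.
have z1 : 1 <= z by rewrite ler_pdivlMr// mul1r ler_nat.
have lnz : ln (N / r'%:R) <= z * ln (N / r%:R).
  have -> : N / r'%:R = N / r%:R * z by rewrite /z mulrA divfK// gt_eqF.
  rewrite lnM ?posrE ?divr_gt0//.
  have : ln (1 + (z - 1)) <= z - 1 by apply: le_ln1Dx; lra.
  have L1 : 1 <= ln (N / r%:R) by rewrite -e2; nra.
  rewrite [1 + _]addrC subrK => lz; set L := ln (N / r%:R) in L1 *.
  have : 0 <= (z - 1) * (L - 1) by rewrite mulr_ge0// subr_ge0.
  by lra.
have az : amp r ^+ 2 * z <= amp r' ^+ 2.
  set v := r%:R `^ (1 / 3) : R; set v' := r'%:R `^ (1 / 3) : R.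
  have w0 : 0 < v by exact: v0.
  have w0' : 0 < v' by exact: v0.
  have vv : v' <= v by rewrite ge0_ler_powR ?nnegrE ?ler0n// ?ler_nat// divr_ge0.
  have -> : amp r ^+ 2 * z = amp r' ^+ 2 * (v' / v).
    have -> : z = v ^+ 3 / v' ^+ 3 by rewrite !cuberoot_pow ?ler0n.
    by rewrite /amp -/v -/v'; field; rewrite !gt_eqF.
  by rewrite ler_piMr ?sqr_ge0// ler_pdivrMr// mul1r.
have L0 : 0 <= ln (N / r%:R) by rewrite -e2 sqr_ge0.
apply: le_trans (ler_wpM2l (sqr_ge0 _) lnz) _.
by rewrite mulrA ler_wpM2r.
Qed.

Lemma amp_half r r' : mid r -> mid r' -> r = (2 * r')%N -> amp r' <= 2 * amp r.
Proof.
move=> m m' rr; rewrite /amp rr natrM powRM ?ler0n// exprMn.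
set v := r'%:R `^ (1 / 3); have w0 : 0 < v by exact: v0.
set t := 2 `^ (1 / 3) : R.
have t0 : 0 < t by exact: powR_gt0.
have t3 : t ^+ 3 = 2 by rewrite cuberoot_pow.
have t2 : t ^+ 2 <= 2.
  have t1 : 1 <= t by rewrite -ler_pow3 ?(ltW t0)// t3 expr1n ler1n.
  by rewrite -t3 (exprSr t 2) ler_peMr// exprn_ge0// ltW.
have -> : 2 * (b ^+ 2 / (t ^+ 2 * v ^+ 2)) = b ^+ 2 / v ^+ 2 * (2 / t ^+ 2).
  by field; rewrite !gt_eqF.
by rewrite ler_peMr ?divr_ge0 ?exprn_ge0 ?(ltW w0)// ler_pdivlMr ?exprn_gt0// mul1r.
Qed.

Lemma quantile_mid r : mid r -> ell r / 2 <= Phibar_inv (r%:R / N).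
Proof.
move=> m; have h0 := N0; have r0 := mid_gt0 m; have /andP[_ rN] := m.
have PE : Phi (- Phibar_inv (r%:R / N)) = r%:R / N.
  by apply: Phi_Phibar_inv; rewrite divr_gt0//= ltr_pdivrMr//; lra.
have lE : - ln (r%:R / N) = ln (N / r%:R) by rewrite -lnV ?posrE ?divr_gt0// invf_div.
have := @Phi_quantile_ge R (Phibar_inv (r%:R / N)); rewrite PE lE; apply.
by rewrite -lerN2 lE opprK; have [<- l2] := ellP m; nra.
Qed.

Lemma quantile_one : `|Phibar_inv (1%:R / N)| <= 2 * Num.sqrt (ln N).
Proof.
have h8 := b8; have h0 := N0; have N256 : 256 <= N.
  have -> : 256 = 2 ^+ 8 :> R by rewrite -natrX.
  by apply: le_trans n_large; rewrite ler_eXn2l ?ltr1n.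
have PE : Phi (- Phibar_inv (1%:R / N)) = 1%:R / N.
  by apply: Phi_Phibar_inv; rewrite divr_gt0//= ltr_pdivrMr//; lra.
have lE : ln (1%:R / N) = - ln N by rewrite mul1r lnV ?posrE.
have l12 := lnN_ge.
have := @Phi_quantile_ge R (Phibar_inv (1%:R / N)); rewrite PE lE opprK => q1.
have {}q1 := q1 ltac:(lra).
have t0 : 0 <= Phibar_inv (1%:R / N) by apply: le_trans q1;
  rewrite divr_ge0// sqrtr_ge0.
have := Phi_le_exp_tail t0 PE; rewrite lE opprK => q2.
rewrite ger0_norm// -[leLHS]ger0_norm// -sqrtr_sqr.
rewrite -[2 in leRHS](@ger0_norm _ 2)// -sqrtr_sqr -sqrtrM ?sqr_ge0// ler_sqrt.
  by rewrite expr2; lra.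
by rewrite mulr_ge0 ?sqr_ge0//; lra.
Qed.

End threshold.

(** Two families of events are kept because errors are charged in two ways: [E] will hold the
    violations at powers of 2, and [E'] the large deviations of the minimum. *)
Lemma expectation_le_covers d (T : measurableType d) (R : realType)
    (P : probability T R) (f : T -> R) (A B : R) (c c' : nat -> R)
    (E E' : nat -> set T) (v : nat -> R) :
  (forall w, 0 <= f w) -> 0 <= A -> (forall j, 0 <= c j) -> (forall j, 0 <= c' j) ->
  (forall j, measurable (E j)) -> (forall j, measurable (E' j)) ->
  (forall j, ((c j)%:E * P (E j) + (c' j)%:E * P (E' j) <= (v j)%:E)%E) ->
  (forall m, \sum_(0 <= j < m) v j <= B) ->
  (forall w, [\/ f w <= A, exists2 j, E j w & f w <= c j |
                 exists2 j, E' j w & f w <= c' j]) ->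
  ('E_P[f] <= (A + B)%:E)%E.
Proof.
move=> f0 A0 c0 c'0 mE mE' cv vB cov.
pose h j w : R := c j * \1_(E j) w + c' j * \1_(E' j) w.
have i0 (D : set T) w : 0 <= \1_D w :> R by rewrite indicE ler0n.
have i1 (D : set T) w : D w -> \1_D w = 1 :> R by move=> Dw; rewrite indicE mem_set.
apply: (expectation_le_series (h := h) (v := v)) => //.
- by move=> j w; rewrite addr_ge0 ?mulr_ge0.
- by move=> j; apply: measurable_funD; apply: measurable_funM => //;
  exact: measurable_indic.
- move=> j; apply: le_trans (cv j); rewrite /h.
  have mI (D : set T) : measurable D -> measurable_fun [set: T] (fun w => (\1_D w :
    R)%:E).
    by move=> mD; apply/measurable_EFinP; exact: measurable_indic.
  under eq_integral do rewrite EFinD !EFinM.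
  rewrite ge0_integralD//=; last 4 first.
  + by move=> w _; rewrite mule_ge0 ?lee_fin.
  + by apply: measurable_funeM; exact: mI.
  + by move=> w _; rewrite mule_ge0 ?lee_fin.
  + by apply: measurable_funeM; exact: mI.
  rewrite !ge0_integralZl_EFin//; try exact: mI;
    try (by move=> w _; rewrite lee_fin).
  by rewrite !integral_indic// !setIT.
- move=> w; have [|[j Ej fj]|[j Ej fj]] := cov w; first by left.
  + right; exists j; rewrite /h i1// mulr1 (le_trans fj)// lerDl mulr_ge0//.
  + right; exists j; rewrite /h (i1 (E' j))// mulr1 (le_trans fj)// lerDr mulr_ge0//.
Qed.

(** Weights [r / n] sum to a constant over powers of 2: the first [i] of them add up to at most
    [2 ^ i / n]. *)
Lemma sum_dyadic_le (R : realType) (n m : nat) : (0 < n)%N ->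
  \sum_(0 <= j < m) (if (2 ^ j <= n)%N then (2 ^ j)%:R / n%:R else 0) <= 2 :> R.
Proof.
move=> n0; have n0' : 0 < n%:R :> R by rewrite ltr0n.
have S i : \sum_(0 <= j < i) (if (2 ^ j <= n)%N then (2 ^ j)%:R / n%:R else 0) <=
  2 ^+ i / n%:R :> R.
  elim: i => [|i IH]; first by rewrite big_geq// divr_ge0// ltW.
  rewrite big_nat_recr//= exprS -natrX.
  have : 0 <= (2 ^ i)%:R / n%:R :> R by rewrite divr_ge0// ltW.
  by rewrite -natrX in IH; case: ifP => _; lra.
elim: m => [|m IH]; first by rewrite big_geq.
case: (leqP (2 ^ m) n) => h; last by rewrite big_nat_recr//= leqNgt h addr0.
apply: (le_trans (S m.+1)); rewrite ler_pdivrMr// exprS ler_wpM2l// -natrX ler_nat//.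
Qed.

Lemma sum_geom_half_le (R : realType) (m : nat) :
  \sum_(0 <= j < m) 2 ^- j <= 2 :> R.
Proof.
suff : \sum_(0 <= j < m) 2 ^- j <= 2 - 2 * 2 ^- m :> R.
  have : 0 < 2 ^- m :> R by rewrite invr_gt0 exprn_gt0.
  by lra.
have e0 i : 0 < 2 ^- i :> R by rewrite invr_gt0 exprn_gt0.
elim: m => [|m IH]; first by rewrite big_geq// expr0 invr1; lra.
rewrite big_nat_recr//= exprS invfM; have := e0 m; lra.
Qed.

(** * Grid indices up to n/256 and their deviations *)

Section grid_structure.
Context d (T : measurableType d) (R : realType) (P : probability T R) (n k : nat).
Variables (eps : 'I_n -> {RV P >-> R}) (pi : 'I_n -> real_law R).
Hypothesis lawE : has_product_law eps pi.
Hypothesis piM : Mbar k pi.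
Hypothesis kn : (k < n)%N.
Local Notation N := (n%:R : R).
Local Notation b := (@root12 R n).
Local Notation mid := (@mid R n).
Local Notation amp := (@amp R n).
Local Notation ell := (@ell R n).
Local Notation cuberatio := (@cuberatio R n).
Hypothesis n_large : 2 ^+ 40 <= N.
Variable c0 : R.
Hypothesis c0_large : 56 <= c0.
Local Notation L := (ln (N / (N - k%:R)) : R).

Lemma grid_cases (r : nat) : r \in Qgrid R n -> 256 * r%:R <= N ->
  r = 1%N \/ mid r /\ exists j, r = (2 ^ j)%N.
Proof.
move=> /mapP[i]; rewrite mem_iota => /andP[i0 i1] rE rN.
have [||E|[j jE jb]] := @qk_values R n n_large i.
- by rewrite i0/=; move: i1; rewrite add1n prednK// (leq_trans _ kn).
- by left; rewrite rE.
- exfalso; have : (n <= 2 * r)%N.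
    by rewrite rE E mul2n -{1}(odd_double_half n) uphalf_half doubleD leq_add2r;
      case: odd.
  rewrite -(ler_nat R) natrM.
  have : 0 < N by apply: lt_le_trans n_large; rewrite exprn_gt0.
  by have := ler0n R r; lra.
- by right; split; [rewrite midE rN rE jE jb|exists j; rewrite rE].
Qed.

Lemma delta_ge0 q : 0 <= delta c0 n q.
Proof.
have c0_0 : 0 <= c0 by exact: le_trans c0_large.
by rewrite /delta; case: ifP => _;
  rewrite mulr_ge0 ?sqrtr_ge0// divr_ge0 ?mulr_ge0 ?powR_ge0 ?sqrtr_ge0.
Qed.

(** Let [u = cuberatio r]. If [r >= 4 * b ^+ 9], then [r / 2] is in the grid with a threshold of
    order at most [u ^+ 2 / b ^+ 6]. Otherwise the index 1 is used: its threshold is of order at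
    most [b ^+ 6], but here [b <= 2 * u], so [b ^+ 6 <= (2 * u) ^+ 12 / b ^+ 6]. The high power of
    [u] will be absorbed by [expR (- u)]. *)
Lemma grid_predecessor (r : nat) : r \in Qgrid R n -> (1 < r)%N -> mid r ->
  exists q, [/\ q \in Qgrid R n, (q < r)%N &
    2 * delta c0 n q <= 2 ^+ 13 * c0 * cuberatio r ^+ 12 / b ^+ 6].
Proof.
move=> rQ r1 m; have /andP[br rN] := m; have b0 := root12_gt0 n_large.
have b8 := root12_ge8 n_large; have NE := @root12E R n.
have u6 := cuberatio_ge6 n_large m; set u := cuberatio r in u6 *.
have c0_0 : 0 <= c0 by exact: le_trans c0_large.
have b60 : 0 < b ^+ 6 by rewrite exprn_gt0.
have [r4|r4] := leP (4 * b ^+ 9) r%:R.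
  have [r1'|[_ [j rj]]] := grid_cases rQ rN; first by rewrite r1' in r1.
  have [i ji] : exists i, j = i.+1 by case: j rj r1 => [|i _ _]; [move->|exists i].
  have rE : r = (2 * 2 ^ i)%N by rewrite rj ji expnS.
  have rE' : r%:R = 2 * (2 ^ i)%:R :> R by rewrite rE natrM.
  have m' : mid (2 ^ i).
    rewrite midE; apply/andP; split; first by rewrite rE' in r4;
      have := exprn_gt0 9 b0; lra.
    by rewrite rE' in rN; have := ler0n R (2 ^ i); lra.
  exists (2 ^ i)%N; split.
  - apply: (pow2_in_grid n_large); rewrite rE' in r4 rN.
    by apply/andP; split; have := ler0n R (2 ^ i); lra.
  - by rewrite rE ltn_Pmull// expn_gt0.
  rewrite (delta_mid n_large)//; have [_ l2] := ellP n_large m'.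
  have a2 := amp_half n_large m m' rE; have ra := amp_cuberatio n_large m;
    rewrite -/u in ra.
  have a0 := amp_gt0 n_large m'.
  have al : amp (2 ^ i) / ell (2 ^ i) <= amp (2 ^ i).
    by rewrite ler_pdivrMr; [nra|lra].
  apply: (@le_trans _ _ (2 * (c0 * (2 * (u ^+ 2 / b ^+ 6))))).
    by rewrite !ler_wpM2l// (le_trans al)// (le_trans a2)// ra.
  rewrite (_ : 2 * _ = 4 * c0 * u ^+ 2 / b ^+ 6); last by ring.
  rewrite ler_wpM2r ?invr_ge0 ?(ltW b60)// (exprD u 10 2).
  have u10 : 1 <= u ^+ 10 by rewrite exprn_ege1//; lra.
  have e13 : 4 <= 2 ^+ 13 :> R by rewrite -natrX ler_nat.
  have u2 : 0 <= u ^+ 2 by rewrite sqr_ge0.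
  have cu : 0 <= c0 * u ^+ 2 by rewrite mulr_ge0.
  have eu : 4 <= 2 ^+ 13 * u ^+ 10 by apply: (le_trans e13); rewrite ler_peMr.
  by have := ler_wpM2r cu eu; lra.
exists 1%N; split => //; first exact: one_in_grid.
rewrite delta_one//.
have N0 : 0 < N by rewrite NE exprn_gt0.
have sN : Num.sqrt (ln N) <= b ^+ 6.
  have -> : b ^+ 6 = Num.sqrt N by rewrite NE (exprM b 6 2) sqrtr_sqr ger0_norm// ltW.
  by rewrite ler_sqrt ?(ltW N0)// ltW// ln_sublinear.
have b2u : b <= 2 * u.
  rewrite -ler_pow3 ?(ltW b0)//; last by lra.
  have u3 := cuberatio_pow3 m; rewrite -/u in u3.
  have r0 : 0 < r%:R :> R by rewrite ltr0n (ltn_trans _ r1).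
  have : b ^+ 3 <= 4 * u ^+ 3.
    rewrite u3 mulrA ler_pdivlMr// NE (exprD b 3 9) [leRHS]mulrCA ler_wpM2l
      ?exprn_ge0 ?(ltW b0) ?(ltW r4)//.
  have : 0 <= u ^+ 3 by rewrite exprn_ge0//; lra.
  have -> : (2 * u) ^+ 3 = 8 * u ^+ 3 by ring.
  lra.
have h : Num.sqrt (ln N) * b ^+ 6 <= (2 * u) ^+ 12.
  apply: (@le_trans _ _ (b ^+ 12));
    first by rewrite (exprD b 6 6) ler_wpM2r// (ltW b60).
  by rewrite ler_pXn2r ?nnegrE ?(ltW b0)//; lra.
rewrite ler_pdivlMr//.
have -> : 2 ^+ 13 * c0 * u ^+ 12 = 2 * c0 * (2 * u) ^+ 12.
  by rewrite (exprMn 12 2 u) (exprS 2 12); ring.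
by rewrite -!mulrA !ler_wpM2l.
Qed.

Lemma prob_deviant_mid (r : nat) (h : R) : mid r -> 0 <= h ->
  h <= ell r / 4 -> L + 6 * amp r <= h * ell r / 4 ->
  (P (deviant eps r h) <= (2 * expR (- cuberatio r))%:E)%E.
Proof.
move=> m h0 hl hL; have r0 := mid_gt0 n_large m; have /andP[br rN] := m.
have b0 := root12_gt0 n_large; have b8 := root12_ge8 n_large.
have q := quantile_mid n_large m.
have a0 := amp_gt0 n_large m; have [_ l2] := ellP n_large m.
have ab := amp_le_root n_large m.
have a12 : amp r * 12 <= 1.
  apply: le_trans ab; rewrite ler_wpM2l ?(ltW a0)//.
  have : 8 ^+ 4 <= b ^+ 4 by rewrite ler_pXn2r ?nnegrE//; lra.
  have : 12 <= 8 ^+ 4 :> R by rewrite -natrX ler_nat.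
  lra.
(* With this [s], the exponent [r * s ^+ 2 / 32] is [36 / 32] times [cuberatio r]. *)
apply: (le_trans (prob_deviant lawE piM (s := 6 * amp r) _ kn _ h0 _ _)).
- by rewrite -!(ltr_nat R) r0/=; lra.
- by apply/andP; split; lra.
- by lra.
- by nra.
rewrite lee_fin ler_wpM2l// ler_expR.
have := amp_sqr n_large m; have : 0 <=
  r%:R * amp r ^+ 2 by rewrite mulr_ge0 ?sqr_ge0// ltW.
by move=> h1 <-; rewrite (exprMn 2 6 (amp r)); lra.
Qed.

End grid_structure.

(** * Risk bound for a given target index *)

(** With [x = v + j], the weight [x + 1] is at most [expR x]. As [v ^+ 2 >= 8 * ln N], the Gaussian
    factor still leaves [N ^- 2 * expR (- j)], and the factor [N + 1] costs one power of [N]. *)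
Lemma gauss_tail_weight (R : realType) (N v : R) (j : nat) :
  1 <= N -> 8 <= v -> 8 * ln N <= v ^+ 2 ->
  6 * (v + j%:R + 1) * ((N + 1) * expR (- (v + j%:R) ^+ 2 / 2)) <= 12 * 2 ^- j / N.
Proof.
move=> N1 v8 vN; have N0 : 0 < N by lra.
set x := v + j%:R; have j0 : 0 <= j%:R :> R by [].
have xe : x + 1 <= expR x by rewrite addrC expR_ge1Dx.
have ex : x + - x ^+ 2 / 2 <= - ln N + (- ln N + - j%:R).
  have : 0 <= (v - 1) * j%:R by rewrite mulr_ge0//; lra.
  by rewrite /x; nra.
have e2 : expR (- j%:R) <= 2 ^- j :> R.
  rewrite expRN -[X in expR X]mulr1 expRM_natl lef_pV2 ?posrE ?exprn_gt0 ?expR_gt0//.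
  by apply: lerXn2r; rewrite ?nnegrE ?expR_ge0//; apply: le_trans (expR_ge1Dx _); lra.
have h : (x + 1) * expR (- x ^+ 2 / 2) <= N^-1 * (N^-1 * 2 ^- j).
  apply: (@le_trans _ _ (expR (x + - x ^+ 2 / 2))).
    by rewrite expRD ler_wpM2r ?expR_ge0.
  apply: (@le_trans _ _ (expR (- ln N + (- ln N + - j%:R)))); first by rewrite ler_expR.
  rewrite !expRD !expRN lnK ?posrE// ler_wpM2l ?invr_ge0 ?(ltW N0)//.
  by rewrite ler_wpM2l ?invr_ge0 ?(ltW N0)// -expRN.
have N1' : (N + 1) * N^-1 <= 2 by rewrite ler_pdivrMr//; lra.
have p0 : 0 <= N^-1 * 2 ^- j by rewrite mulr_ge0 ?invr_ge0 ?exprn_ge0 ?(ltW N0).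
have h1 : (N + 1) * ((x + 1) * expR (- x ^+ 2 / 2)) <=
  (N + 1) * (N^-1 * (N^-1 * 2 ^- j)).
  by rewrite ler_wpM2l//; lra.
have h2 := ler_wpM2r p0 N1'.
rewrite -!mulrA in h2; lra.
Qed.

Section risk.
Context d (T : measurableType d) (R : realType) (P : probability T R) (n k : nat).
Variables (eps : 'I_n -> {RV P >-> R}) (pi : 'I_n -> real_law R).
Hypothesis lawE : has_product_law eps pi.
Hypothesis piM : Mbar k pi.
Hypothesis kn : (k < n)%N.
Local Notation N := (n%:R : R).
Local Notation b := (@root12 R n).
Local Notation mid := (@mid R n).
Local Notation amp := (@amp R n).
Local Notation ell := (@ell R n).
Local Notation cuberatio := (@cuberatio R n).
Hypothesis n_large : 2 ^+ 40 <= N.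
Variables (c0 M : R).
Hypothesis c0_large : 56 <= c0.
Hypothesis pow_expM : forall u : R, 0 <= u -> u ^+ 15 * expR (- u) <= M.
Local Notation L := (ln (N / (N - k%:R)) : R).

Variables (theta : R) (eta : nat -> R) (qs : nat).
Hypothesis qsQ : qs \in Qgrid R n.
Hypothesis qsN : 256 * qs%:R <= N.
Hypothesis eta1 : eta 1%N = delta c0 n 1 / 2.
Hypothesis eta_dev : forall r, r \in Qgrid R n -> (1 < r <= qs)%N ->
  [/\ 0 <= eta r, eta r <= ell r / 4 & L + 6 * amp r <= eta r * ell r / 4].
Hypothesis eta_delta : forall r r', r \in Qgrid R n -> r' \in Qgrid R n ->
  (r' < r <= qs)%N -> eta r + eta r' <= delta c0 n r'.

Let y (w : T) := fun i => theta + eps i w.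
(** Half of [eta 1]: since the quantile at [1 / n] is at most [v] in absolute value, a violation at
    index 1 forces the minimum to deviate by more than [v]. *)
Let v : R := delta c0 n 1 / 4.

Let v_large : 8 <= v /\ 8 * ln N <= v ^+ 2.
Proof.
rewrite /v delta_one//; have l12 := lnN_ge n_large; have c56 := c0_large.
have s2 : Num.sqrt (ln N) ^+ 2 = ln N by rewrite sqr_sqrtr//; lra.
have s3 : 3 <= Num.sqrt (ln N).
  rewrite -[leLHS]ger0_norm// -sqrtr_sqr ler_sqrt; last by lra.
  by rewrite (_ : 3 ^+ 2 = 9) -?natrX//; lra.
set s := Num.sqrt _ in s2 s3 *; split; first by nra.
have h : 14 * s <= c0 * s / 4 by nra.
have : (14 * s) ^+ 2 <= (c0 * s / 4) ^+ 2 by rewrite ler_pXn2r ?nnegrE//; lra.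
have -> : (14 * s) ^+ 2 = 196 * s ^+ 2 by ring.
by rewrite s2; lra.
Qed.

Let extreme (j : nat) : set T := [set w | (#|below eps (v + j%:R) w| < 1)%N] `|`
  [set w | (1 <= #|below eps (- (v + j%:R)) w|)%N].

Let extreme_cover w : eta 1 < `|theta_tilde (y w) 1 - theta| ->
  exists2 j, extreme j w &
    `|theta_tilde (y w) 1 - theta| + delta c0 n 1 <= 6 * (v + j%:R + 1).
Proof.
rewrite eta1 (_ : delta c0 n 1 / 2 = 2 * v); last by rewrite /v; field.
have -> : delta c0 n 1 = 4 * v by rewrite /v; field.
rewrite /theta_tilde; set o := order_stat _ _; set tau := Phibar_inv _ => D1.
have n0 : (0 < n)%N by apply: leq_ltn_trans kn.
have [v8 _] := v_large.
have tauv : `|tau| <= v.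
  have := quantile_one n_large; rewrite -/tau => /le_trans; apply.
  rewrite /v delta_one//; have s0 : 0 <= Num.sqrt (ln N) := sqrtr_ge0 _.
  by have c56 := c0_large; nra.
pose X : R := `|o - theta|.
have DX : `|o + tau - theta| <= X + v.
  have -> : o + tau - theta = (o - theta) + tau by ring.
  by apply: le_trans (ler_normD _ _) _; rewrite lerD2l.
have vX : v < X by lra.
have exj : exists p : nat, X <= v + p%:R.
  exists (Num.truncn X).+1; have := truncnS_gt X; lra.
(* The least [p] is positive because [v < X]; its predecessor [j] satisfies
   [v + j < X <= v + j + 1]. *)
have [[|j] Xj jmin] := ex_minnP exj; first by move: Xj; rewrite addr0 leNgt vX.
exists j; last by move: Xj; rewrite -addn1 natrD; lra.
have jX : v + j%:R < X.
  by rewrite ltNge; apply/negP => /jmin; rewrite ltnn.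
move: jX; rewrite ltr_normr => /orP[lt|lt]; [left|right] => /=.
  by rewrite -(order_stat_gt eps theta)// n0.
have {}lt : o - theta < - (v + j%:R) by lra.
by apply: order_stat_lt lt; rewrite n0.
Qed.

Lemma theta_ad_risk_le :
  ('E_P[fun w => `|theta_ad c0 (y w) - theta|%R] <=
    (eta qs + delta c0 n qs + (2 ^+ 15 * c0 * M + 24) / b ^+ 6)%:E)%E.
Proof.
have b0 := root12_gt0 n_large; have b8 := root12_ge8 n_large.
have b60 : 0 < b ^+ 6 by rewrite exprn_gt0.
have b61 : 1 <= b ^+ 6 by rewrite exprn_ege1//; lra.
have NE := @root12E R n; have n0 : (0 < n)%N by apply: leq_ltn_trans kn.
have N0 : 0 < N by rewrite ltr0n.
have c0_0 : 0 <= c0 by exact: le_trans c0_large.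
have M0 : 0 <= M by have := pow_expM (lexx 0); rewrite expr0n mul0r.
have d0 := delta_ge0 n c0_large.
have [v8 vN] := v_large.
have rN r : (r <= qs)%N -> 256 * r%:R <= N.
  by move=> rq; apply: le_trans qsN; rewrite ler_wpM2l// ler_nat.
pose used j := ((2 ^ j)%N \in Qgrid R n) && (1 < 2 ^ j <= qs)%N.
have W0 j : 0 <= 2 ^+ 13 * c0 * cuberatio (2 ^ j) ^+ 12 / b ^+ 6.
  rewrite divr_ge0 ?(ltW b60)// mulr_ge0 ?exprn_ge0 ?divr_ge0 ?exprn_ge0 ?powR_ge0
    ?(ltW b0)//.
  by rewrite mulr_ge0// exprn_ge0.
have V0 : 0 <= 2 ^+ 14 * c0 / b ^+ 6 by rewrite divr_ge0 ?(ltW b60)// mulr_ge0//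
  exprn_ge0.
(* The cost is 0 when [2 ^ j] is not a grid index in []1, qs]], so that sums can run over all
   exponents. *)
pose c j := if used j then 2 ^+ 13 * c0 * cuberatio (2 ^ j) ^+ 12 / b ^+ 6 else 0.
pose E j := deviant eps (2 ^ j)%N (eta (2 ^ j)%N).
pose c' j := 6 * (v + j%:R + 1).
pose w1 j : R := if (2 ^ j <= n)%N then (2 ^ j)%:R / N else 0.
pose vv j := 2 ^+ 14 * c0 * M / b ^+ 6 * w1 j + 12 / b ^+ 6 * 2 ^- j.
have K0 : 0 <= 2 ^+ 14 * c0 * M / b ^+ 6.
  by rewrite divr_ge0 ?(ltW b60)// mulr_ge0// mulr_ge0// exprn_ge0.
have mid_used j : used j -> mid (2 ^ j)%N.
  move=> /and3P[jQ j1 jq]; have [j1'|[]//] := grid_cases kn n_large jQ (rN _ jq).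
  by rewrite j1' in j1.
apply: (expectation_le_covers (c := c) (c' := c') (E := E) (E' := extreme) (v := vv)).
- by [].
- rewrite addr_ge0//; have [r1|[m [j qj]]] := grid_cases kn n_large qsQ qsN.
    by rewrite r1 eta1 divr_ge0.
  have [|//] := eta_dev qsQ; rewrite leqnn andbT -(ltr_nat R).
  have /andP[h _] := m; apply: lt_le_trans h; rewrite exprn_egt1//; lra.
- by move=> j; rewrite /c; case: ifP.
- by move=> j; rewrite /c'; have := ler0n R j; lra.
- by move=> j; exact: measurable_deviant.
- move=> j; apply: measurableU;
  first exact: (measurable_below _ _ (fun J => (#|J| < 1)%N)).
  exact: (measurable_below _ _ (fun J => (1 <= #|J|)%N)).
- move=> j; rewrite /vv EFinD; apply: leeD.
    have w10 : 0 <= w1 j by rewrite /w1; case: ifP => // _; rewrite divr_ge0// ltW.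
    rewrite /c; case: ifP => uj; last by rewrite mul0e lee_fin mulr_ge0.
    have m := mid_used _ uj; have /and3P[jQ j1 jq] := uj.
    have [e0 e1 e2] := eta_dev jQ (introT andP (conj j1 jq)).
    apply: (@le_trans _ _ ((2 ^+ 13 * c0 * cuberatio (2 ^ j) ^+ 12 / b ^+ 6)%:E *
        (2 * expR (- cuberatio (2 ^ j)))%:E)%E).
      apply: lee_wpmul2l; last exact: (prob_deviant_mid lawE piM kn n_large).
      by rewrite lee_fin W0.
    have u6 := cuberatio_ge6 n_large m; have u3 := cuberatio_pow3 m.
    set u := cuberatio (2 ^ j) in u6 u3 *.
    have u30 : 0 < u ^+ 3 by rewrite exprn_gt0//; lra.
    (* The exponent 15 of [pow_expM] splits as 12, for the threshold bound, plus 3, to keep a factor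
       [u ^- 3 = r / n] that is summable over powers of 2. *)
    have uM : u ^+ 12 * expR (- u) <= M * (u ^+ 3)^-1.
      by rewrite ler_pdivlMr// mulrAC -exprD pow_expM//; lra.
    have r0 := mid_gt0 n_large m.
    have -> : w1 j = (u ^+ 3)^-1.
      rewrite u3 invf_div /w1 ifT// -(ler_nat R); have /andP[_] := m.
      by have := ltW r0; lra.
    rewrite -EFinM lee_fin.
    have -> : 2 ^+ 13 * c0 * u ^+ 12 / b ^+ 6 * (2 * expR (- u)) =
      2 ^+ 14 * c0 / b ^+ 6 * (u ^+ 12 * expR (- u)) by rewrite (exprS 2 13); ring.
    rewrite (_ : _ * u ^- 3 = 2 ^+ 14 * c0 / b ^+ 6 * (M * u ^- 3)); last by ring.
    by rewrite ler_wpM2l.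
  have vj0 : 0 <= v + j%:R by have := ler0n R j; lra.
  apply: (@le_trans _ _ ((c' j)%:E * ((N + 1) * expR (- (v + j%:R) ^+ 2 / 2))%:E)%E).
    apply: lee_wpmul2l; first by rewrite lee_fin /c'; lra.
    exact: (prob_extreme lawE piM).
  rewrite -EFinM lee_fin; apply: (@le_trans _ _ (12 * 2 ^- j / N)).
    by apply: gauss_tail_weight => //; rewrite ler1n.
  rewrite mulrAC ler_wpM2r ?invr_ge0 ?exprn_ge0// ler_wpM2l//.
  by rewrite lef_pV2 ?posrE// NE ler_weXn2l//; lra.
- move=> m; rewrite /vv big_split/= -!mulr_sumr.
  have s1 := sum_dyadic_le R m n0; have s2 := sum_geom_half_le R m.
  apply: (le_trans (lerD (ler_wpM2l K0 s1) (ler_wpM2l _ s2))).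
    by rewrite divr_ge0 ?(ltW b60).
  by rewrite (exprS 2 14) le_eqVlt; apply/orP; left; apply/eqP; field; rewrite gt_eqF.
- move=> w; have [fA|[r [rQ rq er fq]]] :=
  @lepski_cases R n c0 theta (y w) eta qs qsQ (fun r _ => d0 r) eta_delta.
    by constructor 1.
  have [r1|[m [j rj]]] := grid_cases kn n_large rQ (rN _ rq).
    constructor 3; rewrite r1 in er; have [j Ej Dj] := extreme_cover er.
    exists j => //; apply: le_trans Dj; apply: theta_ad_le => //.
      by rewrite -r1.
    (* The index 1 is admissible because 0 is not in the grid. *)
    move=> r' r'Q; rewrite ltnS leqn0 => /eqP r'0.
    exfalso; have r'N : 256 * r'%:R <= N by rewrite r'0 mulr0 ltW.
    have [r'1|[m' _]] := grid_cases kn n_large r'Q r'N; first by rewrite r'0 in r'1.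
    by have := mid_gt0 n_large m'; rewrite r'0 ltxx.
  constructor 2; have r1 : (1 < r)%N.
    rewrite -(ltr_nat R); have /andP[h _] := m; apply: lt_le_trans h.
    by rewrite exprn_egt1//; lra.
  have [q [qQ qr dq]] := grid_predecessor kn n_large c0_large rQ r1 m.
  have [e0 e1 e2] := eta_dev rQ (introT andP (conj r1 rq)).
  exists j.
    by rewrite /E -rj; apply: (deviantP (theta := theta));
      rewrite // (ltnW r1)/= -(ler_nat R); have := rN _ rq; have := ler0n R r; lra.
  rewrite /c ifT; last by rewrite /used -rj rQ r1.
  rewrite -rj; apply: le_trans dq; apply: (le_trans (fq q qQ qr)).
  (* As [eta r >= 0], this gives [eta q <= delta c0 n q], so the error is at most twice the
     threshold of [q]. *)
  have := eta_delta rQ qQ (introT andP (conj qr rq)); lra.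
Qed.

End risk.

(** * Choice of the target index *)

Section rate.
Context {R : realType}.
Variables (n k : nat).
Hypothesis k_range : (0 < k < n)%N.
Local Notation N := (n%:R : R).
Local Notation b := (@root12 R n).
Local Notation mid := (@mid R n).
Local Notation amp := (@amp R n).
Local Notation ell := (@ell R n).
Local Notation cuberatio := (@cuberatio R n).
Hypothesis n_large : 2 ^+ 40 <= N.
Variable c0 : R.
Hypothesis c0_large : 56 <= c0.
Hypothesis c0_n : 2 * c0 <= b ^+ 4.
Local Notation L := (ln (N / (N - k%:R)) : R).
Local Notation rate := (L / Num.sqrt (ln (1 + k%:R ^+ 2 / N))).

Let kn : (k < n)%N. Proof. by case/andP: k_range. Qed.

Lemma L_ge : k%:R / N <= L.
Proof.
have N0 : 0 < N by rewrite ltr0n (leq_ltn_trans _ kn).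
have nk : 0 < N - k%:R by rewrite subr_gt0 ltr_nat kn.
have kN : k%:R / N < 1 by rewrite ltr_pdivrMr// mul1r ltr_nat kn.
have -> : L = - ln (1 - k%:R / N).
  rewrite -lnV ?posrE; last by lra.
  by congr ln; field; rewrite !gt_eqF.
by have := @le_ln1Dx R (- (k%:R / N)); lra.
Qed.

Lemma rate_ge (M : R) : 0 < M -> ln (1 + k%:R ^+ 2 / N) <= M ^+ 2 -> L / M <= rate.
Proof.
move=> M0 lM; have N0 : 0 < N by rewrite ltr0n (leq_ltn_trans _ kn).
have /andP[k0 _] := k_range.
have L0 : 0 <= L by apply: le_trans L_ge; rewrite divr_ge0.
have l0 : 0 < ln (1 + k%:R ^+ 2 / N).
  by apply: ln_gt0; rewrite ltrDl divr_gt0// exprn_gt0// ltr0n.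
rewrite ler_wpM2l// lef_pV2 ?posrE ?sqrtr_gt0//.
by rewrite -[leRHS]ger0_norm ?(ltW M0)// -sqrtr_sqr ler_sqrt// sqr_ge0.
Qed.

(** [L >= k / n], and the denominator is at most [k / sqrt n] by [ln (1 + x) <= x]. This is what
    absorbs the remainder of order [n^(-1/2)]. *)
Lemma rate_ge_root : (b ^+ 6)^-1 <= rate.
Proof.
have N0 : 0 < N by rewrite ltr0n (leq_ltn_trans _ kn).
have b0 := root12_gt0 n_large; have b60 : 0 < b ^+ 6 by rewrite exprn_gt0.
have k0 : 0 < k%:R :> R by rewrite ltr0n; case/andP: k_range.
apply: (le_trans _ (@rate_ge (k%:R / b ^+ 6) _ _)).
- apply: (@le_trans _ _ ((k%:R / N) / (k%:R / b ^+ 6))).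
    by rewrite (@root12E R n) le_eqVlt; apply/orP; left; apply/eqP; field;
      rewrite !gt_eqF.
  by rewrite ler_wpM2r ?L_ge// invr_ge0 divr_ge0// ltW.
- by rewrite divr_gt0.
- apply: le_trans (le_ln1Dx _) _.
    by apply: (@lt_le_trans _ _ 0) => //; rewrite divr_ge0 ?sqr_ge0// ltW.
  by rewrite (@root12E R n) le_eqVlt; apply/orP; left; apply/eqP; field; rewrite gt_eqF.
Qed.

Lemma log_signal_le : ln (1 + k%:R ^+ 2 / N) <= 2 * ln N.
Proof.
have N0 : 0 < N by rewrite ltr0n (leq_ltn_trans _ kn).
have kN : k%:R <= N by rewrite ler_nat ltnW// kn.
have k0 : 0 <= k%:R :> R by [].
have N2 : 2 <= N.
  by apply: le_trans n_large; rewrite ler_eXnr// ler1n.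
rewrite mulr_natl -lnXn// ler_ln ?posrE ?exprn_gt0//.
have : k%:R ^+ 2 / N <= N by rewrite ler_pdivrMr//; nra.
by nra.
Qed.

(** The denominator of the rate is at most [2 * sqrt (ln n)], so the rate is at least
    [sqrt (ln n) / 2000]. *)
Lemma case_extreme : ln N / 1000 <= L ->
  delta c0 n 1 / 2 + delta c0 n 1 <= 4000 * c0 * rate.
Proof.
move=> hL; rewrite delta_one//; have l12 := lnN_ge n_large; have c1 := c0_large.
set s := Num.sqrt (ln N).
have s2 : s ^+ 2 = ln N by rewrite sqr_sqrtr//; lra.
have s0 : 0 < s by rewrite sqrtr_gt0; lra.
have h : L / (2 * s) <= rate.
  apply: rate_ge; first by rewrite mulr_gt0.
  by apply: (le_trans log_signal_le); rewrite exprMn s2; lra.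
have h2 : s / 2000 <= rate.
  by apply: le_trans h; rewrite ler_pdivlMr ?mulr_gt0//; nra.
have c0_0 : 0 <= c0 by lra.
have := ler_wpM2l c0_0 h2; have : 0 <= c0 * s by rewrite mulr_ge0// ltW.
by lra.
Qed.

(** When [L <= amp r], the last inequality follows from [7 * amp r <= c0 * amp r / 8], that is
    [c0 >= 56]. The upper bound on the threshold uses [2 * c0 * amp r <= 1], true for [n] large in
    terms of [c0]. *)
Lemma half_threshold_ok r : mid r -> L <= amp r ->
  [/\ 0 <= delta c0 n r / 2, delta c0 n r / 2 <= ell r / 4 &
      L + 6 * amp r <= delta c0 n r / 2 * ell r / 4].
Proof.
move=> m La; have b0 := root12_gt0 n_large; have c1 := c0_large; have c2 := c0_n.
have a0 := amp_gt0 n_large m; have [_ l2] := ellP n_large m.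
have ab := amp_le_root n_large m.
have l0 : 0 < ell r by lra.
have ca : 2 * c0 * amp r <= 1.
  by apply: le_trans ab; rewrite mulrC ler_wpM2l// ltW.
have e : delta c0 n r * ell r = c0 * amp r.
  by rewrite delta_mid// -mulrA divfK// gt_eqF.
have d0 := delta_ge0 n c0_large r.
split; first by rewrite divr_ge0.
- have : delta c0 n r <= ell r / 2.
    by rewrite -(ler_pM2r l0) e; nra.
  by lra.
- set D := delta c0 n r in e *; have -> : D / 2 * ell r / 4 = D * ell r / 8 by lra.
  by rewrite e; nra.
Qed.

Lemma ler_delta r r' : mid r -> mid r' -> (r' <= r)%N ->
  delta c0 n r <= delta c0 n r'.
Proof.
move=> m m' rr; rewrite !delta_mid// ler_wpM2l ?(le_trans _ c0_large)//.
exact: ler_amp_ell.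
Qed.

Lemma delta_le_one r : mid r -> delta c0 n r <= delta c0 n 1.
Proof.
move=> m; have c0_0 : 0 <= c0 by exact: le_trans c0_large.
have l12 := lnN_ge n_large; have a0 := amp_gt0 n_large m.
have [_ l2] := ellP n_large m; have ab := amp_le_root n_large m.
rewrite delta_mid// delta_one// ler_wpM2l//.
have s1 : 1 <= Num.sqrt (ln N) by rewrite -[leLHS]sqrtr1 ler_sqrt; lra.
apply: le_trans s1; rewrite ler_pdivrMr; last by lra.
have b41 : 1 <= b ^+ 4 by rewrite exprn_ege1//; have := root12_ge8 n_large; lra.
by nra.
Qed.

(** If [r] is within a factor 2 of [n / 256], then [amp r] is of order [n^(-1/2)], below the rate.
    Otherwise [k / n <= L <= amp r] yields [k^2 / n <= (n / r)^(4/3)], so the denominator of the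
    rate is at most [2 * ell r], while [amp r <= 2 * L]. *)
Lemma case_interior r : mid r -> L <= amp r ->
  N < 512 * r%:R \/ amp r <= 2 * L ->
  delta c0 n r / 2 + delta c0 n r <= 4000 * c0 * rate.
Proof.
move=> m La; have b0 := root12_gt0 n_large; have b60 : 0 < b ^+ 6 by rewrite exprn_gt0.
have N0 : 0 < N by rewrite ltr0n (leq_ltn_trans _ kn).
have c0_0 : 0 <= c0 by exact: le_trans c0_large.
have [e2 l2] := ellP n_large m; have a0 := amp_gt0 n_large m.
have r0 := mid_gt0 n_large m; have u6 := cuberatio_ge6 n_large m.
have u3 := cuberatio_pow3 m; have au := amp_cuberatio n_large m.
have l0 : 0 < ell r by lra.
have rr := rate_ge_root; rewrite delta_mid//.
move=> [rN|aL].
  have u8 : cuberatio r <= 8.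
    rewrite -ler_pow3//; last by lra.
    rewrite u3 ler_pdivrMr//; have -> : 8 ^+ 3 = 512 :> R by rewrite -natrX.
    by lra.
  have ae : amp r / ell r <= amp r by rewrite ler_pdivrMr//; nra.
  have a64 : amp r <= 64 * (b ^+ 6)^-1.
    by rewrite au ler_wpM2r ?invr_ge0 ?(ltW b60)//; nra.
  have h : amp r / ell r <= 64 * rate by lra.
  have rt0 : 0 <= rate by apply: le_trans rr; rewrite invr_ge0 ltW.
  have := ler_wpM2l c0_0 h; have : 0 <= c0 * rate by rewrite mulr_ge0.
  by lra.
have h : L / (2 * ell r) <= rate.
  apply: rate_ge; first by rewrite mulr_gt0.
  have kL : k%:R / N <= cuberatio r ^+ 2 / b ^+ 6 by rewrite -au;
    exact: le_trans L_ge La.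
  have kk : k%:R ^+ 2 / N <= cuberatio r ^+ 4.
    have -> : k%:R ^+ 2 / N = (k%:R / N * b ^+ 6) ^+ 2.
      by rewrite exprMn -exprM -(@root12E R n); field; rewrite gt_eqF.
    rewrite (exprM _ 2 2) ler_pXn2r// ?nnegrE ?sqr_ge0//.
      by rewrite -ler_pdivlMr.
    by rewrite mulr_ge0 ?divr_ge0 ?exprn_ge0// ltW.
  have -> : (2 * ell r) ^+ 2 = 4 * ln (N / r%:R) by rewrite exprMn e2; ring.
  rewrite -u3; apply: (@le_trans _ _ (ln ((cuberatio r ^+ 3) ^+ 2))).
    rewrite ler_ln ?posrE//.
    - have u4 : 1 <= cuberatio r ^+ 4 by rewrite exprn_ege1//; lra.
      have u2 : 2 <= cuberatio r ^+ 2 by nra.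
      have u40 : 0 <= cuberatio r ^+ 4 by lra.
      have := ler_wpM2l u40 u2.
      by rewrite -exprM (exprD _ 4 2); lra.
    - by rewrite !exprn_gt0//; lra.
  rewrite lnXn ?exprn_gt0//; last by lra.
  by rewrite mulr2n u3 -e2; nra.
have h2 : amp r / ell r <= 4 * rate.
  have : amp r / ell r <= 4 * (L / (2 * ell r)).
    rewrite ler_pdivrMr//.
    have -> : 4 * (L / (2 * ell r)) * ell r = 2 * L by field; rewrite gt_eqF.
    by [].
  by lra.
have rt0 : 0 <= rate by apply: le_trans rr; rewrite invr_ge0 ltW.
have := ler_wpM2l c0_0 h2; have : 0 <= c0 * rate by rewrite mulr_ge0.
by lra.
Qed.

(** Here [ln (n / r)] is of order [ln n], so the denominator of the rate is at most [4 * ell r]; the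
    bias [L / ell r] is then of the order of the rate and dominates [amp r / ell r]. *)
Lemma case_coarsest r : mid r -> amp r < L -> ln N <= 8 * ell r ^+ 2 ->
  28 * L / ell r + delta c0 n r <= 4000 * c0 * rate.
Proof.
move=> m La lN; have c1 := c0_large; have c0_0 : 0 <= c0 by lra.
have [e2 l2] := ellP n_large m; have a0 := amp_gt0 n_large m.
have l0 : 0 < ell r by lra.
have h : L / (4 * ell r) <= rate.
  apply: rate_ge; first by rewrite mulr_gt0.
  apply: (le_trans log_signal_le); rewrite exprMn; lra.
set x := L / ell r.
have h1 : x <= 4 * rate.
  have -> : x = 4 * (L / (4 * ell r)) by rewrite /x; field; rewrite gt_eqF.
  by lra.
have h2 : amp r / ell r <= x by rewrite ler_wpM2r ?invr_ge0 ?(ltW l0)// ltW.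
have x0 : 0 <= x by apply: le_trans h2; rewrite divr_ge0// ltW.
rewrite delta_mid// -[28 * L / _]mulrA -/x.
have h3 := ler_wpM2l c0_0 h2; have h4 := ler_wpM2l c0_0 h1.
have h5 : 28 * x <= c0 * x by rewrite ler_wpM2r//; lra.
have h6 : 0 <= c0 * x by rewrite mulr_ge0.
by lra.
Qed.

Lemma root12_pow3_ge : 1024 <= b ^+ 3.
Proof.
have b0 := root12_gt0 n_large; have b30 : 0 <= b ^+ 3 by rewrite exprn_ge0// ltW.
have -> : 1024 = 2 ^+ 10 :> R by rewrite -natrX.
rewrite -(@ler_pXn2r _ 4) ?nnegrE ?exprn_ge0 ?(ltW b0)//.
by rewrite -!exprM -(@root12E R n).
Qed.

Lemma coarse_pow2 : exists2 j : nat,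
  (2 ^ j)%N \in Qgrid R n & (1 < 2 ^ j)%N && ((2 ^ j)%:R <= 4 * b ^+ 9).
Proof.
have b0 := root12_gt0 n_large; have b8 := root12_ge8 n_large.
have b9 : 8 <= b ^+ 9 by rewrite (le_trans b8)// ler_eXnr//; lra.
have exj : exists j : nat, 2 * b ^+ 9 <= (2 ^ j)%:R.
  exists (Num.truncn (2 * b ^+ 9)).+1; apply: ltW.
  by apply: (lt_trans (truncnS_gt _)); rewrite ltr_nat ltn_expl.
have [[|j] j1 jmin] := ex_minnP exj; first by rewrite expn0 in j1; lra.
have j2 : (2 ^ j.+1)%:R <= 4 * b ^+ 9.
  have : (2 ^ j)%:R < 2 * b ^+ 9.
    by rewrite ltNge; apply/negP => /jmin; rewrite ltnn.
  by rewrite expnS natrM; lra.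
exists j.+1; last by rewrite j2 andbT -(ltr_nat R); lra.
apply: pow2_in_grid => //; rewrite j1/= (le_trans j2)//.
have b3 := root12_pow3_ge; rewrite (@root12E R n) (exprD b 3 9).
have h : 0 <= b ^+ 9 by lra.
by have := ler_wpM2r h b3; lra.
Qed.

Lemma lepski_target : exists (qs : nat) (eta : nat -> R),
  [/\ qs \in Qgrid R n, 256 * qs%:R <= N, eta 1%N = delta c0 n 1 / 2,
      forall r, r \in Qgrid R n -> (1 < r <= qs)%N ->
        [/\ 0 <= eta r, eta r <= ell r / 4 & L + 6 * amp r <= eta r * ell r / 4] &
      (forall r r', r \in Qgrid R n -> r' \in Qgrid R n -> (r' < r <= qs)%N ->
        eta r + eta r' <= delta c0 n r') /\
      eta qs + delta c0 n qs <= 4000 * c0 * rate].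
Proof.
have b0 := root12_gt0 n_large; have b8 := root12_ge8 n_large.
have b9 : 0 <= b ^+ 9 by rewrite exprn_ge0// ltW.
have N0 : 0 < N by rewrite ltr0n (leq_ltn_trans _ kn).
have N256 : 256 <= N.
  have -> : 256 = 2 ^+ 8 :> R by rewrite -natrX.
  by apply: le_trans n_large; rewrite ler_eXn2l ?ltr1n.
have grid r : r \in Qgrid R n -> (1 < r)%N -> 256 * r%:R <= N -> mid r.
  by move=> rQ r1 rN; have [r1'|[]//] := grid_cases kn n_large rQ rN; rewrite r1' in r1.
have grid0 r : r \in Qgrid R n -> 256 * r%:R <= N -> (0 < r)%N.
  move=> rQ rN; have [->//|[m _]] := grid_cases kn n_large rQ rN.
  by rewrite -(ltr_nat R) (mid_gt0 n_large m).
have down r q : (r <= q)%N -> 256 * q%:R <= N -> 256 * r%:R <= N.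
  by move=> rq qN; apply: le_trans qN; rewrite ler_wpM2l// ler_nat.
have Q1 := one_in_grid n_large.
have d0 := delta_ge0 n c0_large.
have [Lbig|Lsmall] := leP (ln N / 1000) L.
  exists 1%N, (fun r => delta c0 n r / 2); split => //; first by rewrite mulr1.
    by move=> r _ /andP[r1]; rewrite leqNgt r1.
  split; last exact: case_extreme.
  move=> r r' rQ r'Q /andP[r'r r1]; exfalso.
  have /(_ (down _ _ (leq_trans (ltnW r'r) r1) _)) := grid0 r' r'Q.
  rewrite mulr1 => /(_ N256) r'0.
  by have := leq_trans r'r r1; rewrite ltnS leqn0 eqn0Ngt r'0.
have [j jQ /andP[j1 j9]] := coarse_pow2.
have jN : 256 * (2 ^ j)%:R <= N.
  have b3 := root12_pow3_ge; rewrite (@root12E R n) (exprD b 3 9).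
  by have := ler_wpM2r b9 b3; lra.
pose interior r := [&& r \in Qgrid R n, (1 < r)%N, 256 * r%:R <= N & L <= amp r].
have [exr|nor] := pselect (exists r, interior r).
  have bound r : interior r -> (r <= n)%N.
    move=> /and4P[_ _ rN _]; rewrite -(ler_nat R); have := ler0n R r; lra.
  have [q /and4P[qQ q1 qN qL] qmax] := ex_maxnP exr bound.
  have mq := grid q qQ q1 qN.
  exists q, (fun r => delta c0 n r / 2); split => //.
    move=> r rQ /andP[r1 rq]; have m := grid r rQ r1 (down _ _ rq qN).
    apply: half_threshold_ok => //; apply: le_trans qL _; exact: ler_amp.
  split.
    move=> r r' rQ r'Q /andP[r'r rq]; have rN := down _ _ rq qN.
    have r'N := down _ _ (ltnW r'r) rN; have r'0 := grid0 r' r'Q r'N.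
    have m := grid r rQ (leq_ltn_trans r'0 r'r) rN.
    suff : delta c0 n r <= delta c0 n r' by lra.
    have := r'0; rewrite leq_eqVlt => /predU1P[<-|r'1]; first exact: delta_le_one.
    by apply: ler_delta => //; [exact: grid|exact: ltnW].
  apply: case_interior => //.
  have [qN2|qN2] := ltP N (512 * q%:R); [by left|right].
  (* The next power of 2 is in the grid and below [n / 256], so maximality of [q] gives
     [amp (2 * q) <= L]. *)
  have [_ [i qi]] : mid q /\ exists i, q = (2 ^ i)%N.
    by have [q1'|//] := grid_cases kn n_large qQ qN; rewrite q1' in q1.
  have /andP[bq _] := mq.
  have q2Q : (2 ^ i.+1)%N \in Qgrid R n.
    apply: (pow2_in_grid n_large); rewrite expnS natrM -qi.
    by apply/andP; split; have := ler0n R q; lra.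
  have q2 : (2 ^ i.+1)%N = (2 * q)%N by rewrite expnS qi.
  have q2N : 256 * (2 * q)%:R <= N by rewrite natrM; lra.
  have q21 : (1 < 2 * q)%N by rewrite (leq_trans q1)// leq_pmull.
  rewrite q2 in q2Q; have m2 := grid _ q2Q q21 q2N.
  have aL : amp (2 * q) <= L.
    rewrite leNgt; apply/negP => La.
    have /qmax : interior (2 * q)%N by rewrite /interior q2Q q21 q2N (ltW La).
    by rewrite leqNgt ltn_Pmull// ltnW.
  by have := amp_half n_large m2 mq erefl; lra.
have exq : exists q, (q \in Qgrid R n) && (1 < q)%N.
  by exists (2 ^ j)%N; rewrite jQ.
have [q /andP[qQ q1] qmin] := ex_minnP exq.
have qj : (q <= 2 ^ j)%N by apply: qmin; rewrite jQ.
have qN := down _ _ qj jN; have m := grid q qQ q1 qN.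
have q9 : q%:R <= 4 * b ^+ 9 by apply: le_trans j9; rewrite ler_nat.
have La : amp q < L.
  rewrite ltNge; apply/negP => h; apply: nor; exists q.
  by rewrite /interior qQ q1 qN.
have [e2 l2] := ellP n_large m; have a0 := amp_gt0 n_large m.
have q0 := mid_gt0 n_large m.
(* [q <= 4 * n^(3/4)] gives [n / q >= b ^+ 3 / 4], whose eighth power exceeds [n]. *)
have lN : ln N <= 8 * ell q ^+ 2.
  rewrite e2 mulr_natl -lnXn ?divr_gt0// ler_ln ?posrE ?exprn_gt0 ?divr_gt0//.
  have b3 := root12_pow3_ge; have b30 : 0 < b ^+ 3 by rewrite exprn_gt0.
  have h : b ^+ 3 / 4 <= N / q%:R.
    rewrite ler_pdivlMr// (@root12E R n) (exprD b 3 9).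
    by have := ler_wpM2l (ltW b30) q9; lra.
  apply: (@le_trans _ _ ((b ^+ 3 / 4) ^+ 8)); last first.
    by rewrite ler_pXn2r// ?nnegrE ?divr_ge0// ltW.
  apply: (@le_trans _ _ ((b ^+ 3) ^+ 4)); first by rewrite -exprM -(@root12E R n).
  rewrite expr_div_n (exprD _ 4 4) -mulrA ler_peMr ?exprn_ge0 ?(ltW b0)//.
  rewrite ler_pdivlMr ?exprn_gt0// mul1r (exprM 4 2 4) ler_pXn2r ?nnegrE ?exprn_ge0
    ?(ltW b0)//.
  by have -> : 4 ^+ 2 = 16 :> R by [rewrite -natrX]; lra.
have l0 : 0 < ell q by lra.
have L0 : 0 <= L by lra.
(* The constant 28 makes [eta q * ell q / 4] equal to [7 * L], which exceeds [L + 6 * amp q]. The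
   bound [eta q <= ell q / 4] then follows from [L < ln n / 1000] and [ln n <= 8 * ell q ^+ 2]. *)
pose eta r := if r == q then 28 * L / ell q else delta c0 n r / 2.
have eq1 : (1 == q)%N = false by rewrite ltn_eqF.
have etaq : eta q = 28 * L / ell q by rewrite /eta eqxx.
have eta1 : eta 1%N = delta c0 n 1 / 2 by rewrite /eta eq1.
have only r : r \in Qgrid R n -> (1 < r)%N -> (r <= q)%N -> r = q.
  by move=> rQ r1 rq; apply/eqP; rewrite eqn_leq rq qmin// rQ.
have e28 : 28 * L / ell q <= ell q / 4.
  by rewrite ler_pdivrMr//; lra.
exists q, eta; split => //.
  move=> r rQ /andP[r1 rq]; rewrite (only r)//; rewrite etaq; split => //.
    by rewrite divr_ge0 ?mulr_ge0// ltW.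
  have -> : 28 * L / ell q * ell q / 4 = 7 * L by field; rewrite gt_eqF.
  by lra.
split; last by rewrite etaq; exact: case_coarsest.
move=> r r' rQ r'Q /andP[r'r rq]; have rN := down _ _ rq qN.
have r'0 := grid0 r' r'Q (down _ _ (ltnW r'r) rN).
have rE := only r rQ (leq_ltn_trans r'0 r'r) rq.
have r'1 : r' = 1%N.
  apply/eqP; rewrite eqn_leq r'0 andbT leqNgt; apply/negP => r'1.
  by have := only r' r'Q r'1 (leq_trans (ltnW r'r) rq); move: r'r;
    rewrite rE => /[swap] ->; rewrite ltnn.
rewrite rE r'1 etaq eta1 delta_one//; have l12 := lnN_ge n_large.
have ls : ell q <= Num.sqrt (ln N).
  rewrite /ell ler_sqrt; last by lra.
  rewrite ler_ln ?posrE ?divr_gt0// ler_pdivrMr// ler_peMr ?(ltW N0)//.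
  by rewrite ler1n ltnW.
have c1 := c0_large; have := sqrtr_ge0 (ln N) => s0.
have : 56 * Num.sqrt (ln N) <= c0 * Num.sqrt (ln N) by rewrite ler_wpM2r.
lra.
Qed.

End rate.

Theorem proposition3p4 (R : realType) :
  exists c0min : R, 0 < c0min /\
  forall c0 : R, c0min <= c0 ->
  exists (c : R) (n0 : nat), [/\ 0 < c, (0 < n0)%N &
  forall (n k : nat), (n0 <= n)%N -> (1 <= k <= n.-1)%N ->
  forall (theta : R) (pi : 'I_n -> real_law R), Mbar k pi ->
  forall (d : measure_display) (T : measurableType d) (P : probability T R)
         (eps : 'I_n -> {RV P >-> R}), has_product_law eps pi ->
  ('E_P[fun w => `|theta_ad c0 (fun i => theta + eps i w)%R - theta|%R]
     <= (c * (ln (n%:R / (n%:R - k%:R)) /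
              Num.sqrt (ln (1 + k%:R ^+ 2 / n%:R))))%:E)%E].
Proof.
exists 56; split => // c0 c0_large.
have [M M0 pow_expM] := @pow_expRN_le R 14.
have c0_0 : 0 < c0 by apply: lt_le_trans c0_large.
pose K := 2 ^+ 15 * c0 * M + 24.
have K0 : 0 < K by rewrite ltr_pwDr// !mulr_ge0 ?exprn_ge0 ?ltW.
(* This threshold ensures both [n >= 2 ^+ 40] and [2 * c0 <= n^(1/3) = b ^+ 4]. *)
have [m mbig] : exists m : nat, 2 ^+ 40 + (2 * c0) ^+ 3 <= m.+1%:R :> R.
  by exists (Num.truncn (2 ^+ 40 + (2 * c0) ^+ 3)); apply: ltW; exact: truncnS_gt.
have A0 : 0 < 4000 * c0 by rewrite mulr_gt0 ?ltr0n.
exists (4000 * c0 + K), m.+1; split; [exact: addr_gt0|exact: ltn0Sn|].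
move=> n k n0n /andP[k0 kn1] theta pi piM d T P eps lawE.
have n0 : (0 < n)%N by apply: leq_ltn_trans n0n.
have k_range : (0 < k < n)%N by rewrite k0 -ltnS -(prednK n0) ltnS in kn1 *.
have nbig : 2 ^+ 40 + (2 * c0) ^+ 3 <= n%:R :> R.
  by apply: (le_trans mbig); rewrite ler_nat.
have c3 : 0 <= (2 * c0) ^+ 3 by rewrite exprn_ge0 ?mulr_ge0// ltW.
have p40 : 0 <= 2 ^+ 40 :> R by rewrite exprn_ge0.
have n_large : 2 ^+ 40 <= n%:R :> R by lra.
have b0 := root12_gt0 n_large.
have c0_n : 2 * c0 <= root12 n ^+ 4.
  rewrite -ler_pow3 ?mulr_ge0 ?exprn_ge0 ?(ltW b0) ?(ltW c0_0)//.
  by rewrite -exprM -root12E; lra.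
have [_ kn] := andP k_range.
have [qs [eta [qsQ qsN eta1 eta_dev [eta_delta qsr]]]] :=
  lepski_target k_range n_large c0_large c0_n.
apply: le_trans (theta_ad_risk_le lawE piM kn n_large c0_large pow_expM theta
  qsQ qsN eta1 eta_dev eta_delta) _.
rewrite lee_fin [leRHS]mulrDl; apply: lerD; first exact: qsr.
by rewrite -/K ler_wpM2l ?(ltW K0)// rate_ge_root.
Qed.
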